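(* Let $A,B,N,\Omega_A,\Omega_B,\Lambda_N,\Lambda_{N^{T}},\mathcal H_N$ be as in the context. For $f\in C(\Omega_A)$ put $$\mathcal I_N f(x)=\sum_{k\in\Lambda_N} f(B^{-T}k)\,\Psi^{A}_{\Omega_B}(x-B^{-T}k),\qquad \Psi^{A}_{\Omega_B}(x)=\frac{1}{|\det N|}\sum_{j\in\Lambda_{N^{T}}} e^{2\pi i\, j^{T}A^{-1}x}.$$ Then $\mathcal I_N$ is the unique interpolation operator on $\Lambda_N$ in $\mathcal H_N$; that is, for each $f \in C(\Omega_A)$, $\mathcal I_N f$ is the unique element of $\mathcal H_N$ satisfying $$\mathcal I_N f(B^{-T}j)=f(B^{-T}j)\qquad\text{for all } j\in\Lambda_N .$$ In particular, $\#\Lambda_N=\#\Lambda_{N^{T}}=|\det N|$. Furthermore, the fundamental interpolation function $\Psi^A_{\Omega_B}$ satisfies $$\Psi^{A}_{\Omega_B}(x)=\sum_{j\in\mathbb Z^d}\Psi_{\Omega_B}(x+Aj),\qquad\text{where } \Psi_{\Omega_B}(x)=\frac{1}{|\det B|}\int_{\Omega_B}e^{2\pi i x\cdot\xi}\,d\xi .$$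
   Context: $A$ and $B$ are nonsingular real $d\times d$ matrices such that all entries of $N:=B^{T}A$ are integers. $\Omega_A,\Omega_B\subset\mathbb R^d$ are bounded measurable sets containing $0$ in their interiors such that $\Omega=\Omega_A$ tiles $\mathbb R^d$ pointwise and without overlap with the lattice $A\mathbb Z^d$, i.e. $\sum_{k\in\mathbb Z^d}\chi_{\Omega}(x+Ak)=1$ for all $x\in\mathbb R^d$ and $(\Omega+Ak)\cap(\Omega+Aj)=\emptyset$ for $k\neq j$ in $\mathbb Z^d$; likewise $\Omega_B$ with $B\mathbb Z^d$. $\chi_\Omega$ is the characteristic function of $\Omega$. Write $M^{-T}=(M^{T})^{-1}$. Define $\Lambda_N=\{k\in\mathbb Z^d: B^{-T}k\in\Omega_A\}$, $\Lambda_{N^{T}}=\{k\in\mathbb Z^d: A^{-T}k\in\Omega_B\}$, and $\mathcal H_N=\mathrm{span}_{\mathbb C}\{\phi_k: k\in\Lambda_{N^{T}}\}$ with $\phi_k(x)=e^{2\pi i k^{T}A^{-1}x}$. $C(\Omega_A)$ is the space of continuous complex functions on $\Omega_A$, and $\#\Lambda$ denotes the number of points of $\Lambda$.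
   Formalization: The last identity is proved only when no point A^{-T}k, k in Z^d, lies on the boundary of Omega_B (it fails for A=2, B=1, Omega_B=[-1/2,1/2)), and its series over Z^d, not absolutely convergent in general, is summed in the Cesàro sense over boxes. *)

(* Defs.v *)
From HB Require Import structures.
From mathcomp Require Import all_boot all_order all_algebra.
From mathcomp Require Import complex.
From mathcomp Require Import all_classical all_reals all_analysis.
Import Order.TTheory GRing.Theory Num.Theory.
Import numFieldNormedType.Exports.

Set Implicit Arguments.
Unset Strict Implicit.
Unset Printing Implicit Defensive.

Local Open Scope classical_set_scope.
Local Open Scope ring_scope.

(* R^d is 'cV[R]_d. Its Lebesgue measure lebesgueV is built as the completion
   of the d-fold product of lebesgue_measure, on the sigma-algebra generated by
   the coordinates; lebV R d is 'cV[R]_d with the Lebesgue-measurable sets. *)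
Definition cylinders (R : realType) d : set (set 'cV[R]_d) :=
  \bigcup_i preimage_set_system setT (fun x : 'cV[R]_d => x i 0)
              (@measurable _ (measurableTypeR R)).

Definition borelV (R : realType) d := g_sigma_algebraType (@cylinders R d).

Definition consV (R : realType) d (p : measurableTypeR R * borelV R d) :
    borelV R d.+1 :=
  \col_(i < d.+1) if unlift 0 i is Some j then p.2 j 0 else p.1.

Definition unconsV (R : realType) d (x : borelV R d.+1) :
    measurableTypeR R * borelV R d :=
  (x 0 0, \col_(i < d) x (lift 0 i) 0).

Lemma consVK (R : realType) d : cancel (@consV R d) (@unconsV R d).
Proof.
move=> [t x]; rewrite /unconsV /consV /= mxE unlift_none; congr pair.
by apply/colP => i; rewrite !mxE liftK.
Qed.

Lemma measurable_coordV (R : realType) d i :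
  measurable_fun setT (fun x : borelV R d => x i 0 : measurableTypeR R).
Proof.
by move=> _ B mB; apply: sub_sigma_algebra; exists i => //; exists B.
Qed.

Lemma measurable_funV (R : realType) d d' (T : measurableType d')
    (f : T -> borelV R d) :
  (forall i, measurable_fun setT (fun t => f t i 0 : measurableTypeR R)) ->
  measurable_fun setT f.
Proof.
move=> mf; apply: (@measurability _ _ T (borelV R d) setT f (@cylinders R d)) => // _ [_ [i _ [B mB <-]] <-].
by have := mf i measurableT B mB; rewrite !setTI.
Qed.

Lemma measurable_consV (R : realType) d : measurable_fun setT (@consV R d).
Proof.
apply: measurable_funV => i; rewrite /consV.
under eq_fun do rewrite mxE.
case: (unlift 0 i) => [j|]; last exact: measurable_fst.
exact: (measurableT_comp (@measurable_coordV R d j) measurable_snd).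
Qed.

Lemma measurable_unconsV (R : realType) d : measurable_fun setT (@unconsV R d).
Proof.
apply/measurable_fun_pairP; split; first exact: measurable_coordV.
apply: measurable_funV => i /=; under eq_fun do rewrite /= mxE.
exact: measurable_coordV.
Qed.

HB.instance Definition _ (R : realType) d :=
  isMeasurableFun.Build _ _ _ _ (@consV R d) (@measurable_consV R d).

Lemma sigma_finite_product d1 d2 (T1 : measurableType d1)
    (T2 : measurableType d2) (R : realType)
    (m1 : {sigma_finite_measure set T1 -> \bar R})
    (m2 : {sigma_finite_measure set T2 -> \bar R}) :
  sigma_finite setT (m1 \x m2)%E.
Proof.
have /sigma_finiteP[F [TF ndF Foo]] := sigma_finiteT m1.
have /sigma_finiteP[G [TG ndG Goo]] := sigma_finiteT m2.
exists (fun n => F n `*` G n).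
  rewrite -setXTT TF TG predeqE => -[x y]; split.
    move=> [/= [n _ Fnx] [k _ Gky]]; exists (maxn n k) => //; split.
    - by move: x Fnx; exact/subsetPset/ndF/leq_maxl.
    - by move: y Gky; exact/subsetPset/ndG/leq_maxr.
  by move=> [n _ []/= ? ?]; split; exists n.
move=> k; have [? ?] := Foo k; have [? ?] := Goo k.
split; first exact: measurableX.
by rewrite product_measure1E// lte_mul_pinfty// ge0_fin_numE.
Qed.

Section lebesgue_succ.
Context (R : realType) (d : nat).
Variable mu : {sigma_finite_measure set (borelV R d) -> \bar R}.

Definition lebesgue_succ : set (borelV R d.+1) -> \bar R :=
  pushforward (@lebesgue_measure R \x mu)%E (@consV R d).

Let lebesgue_succ0 : lebesgue_succ set0 = 0%E.
Proof. exact: measure0. Qed.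

Let lebesgue_succ_ge0 A : (0 <= lebesgue_succ A)%E.
Proof. exact: measure_ge0. Qed.

Let lebesgue_succ_sigma_additive : semi_sigma_additive lebesgue_succ.
Proof. exact: measure_semi_sigma_additive. Qed.

HB.instance Definition _ := isMeasure.Build _ _ _ lebesgue_succ
  lebesgue_succ0 lebesgue_succ_ge0 lebesgue_succ_sigma_additive.

Let lebesgue_succ_sigma_finite : sigma_finite setT lebesgue_succ.
Proof.
have [F UF mF] := sigma_finite_product (@lebesgue_measure R) mu.
exists (fun n => @unconsV R d @^-1` F n).
  by rewrite -preimage_bigcup -UF.
move=> n; have [mFn Foo] := mF n; split.
  by rewrite -[X in measurable X]setTI; exact: measurable_unconsV.
rewrite /lebesgue_succ /pushforward -comp_preimage.
suff -> : (@unconsV R d \o @consV R d) @^-1` F n = F n by [].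
by apply/seteqP; split => p; rewrite /preimage /= consVK.
Qed.

HB.instance Definition _ :=
  Measure_isSigmaFinite.Build _ _ _ lebesgue_succ lebesgue_succ_sigma_finite.

End lebesgue_succ.

Fixpoint borel_lebesgue (R : realType) d :
    {sigma_finite_measure set (borelV R d) -> \bar R} :=
  match d with
  | 0%N => @dirac _ (borelV R 0) (0 : 'cV[R]_0) R
  | d'.+1 => lebesgue_succ (borel_lebesgue R d')
  end.

Definition lebV (R : realType) d :=
  caratheodory_type (mu_ext (@borel_lebesgue R d)).

Definition lebesgueV (R : realType) d : {measure set (lebV R d) -> \bar R} :=
  @completed_measure_extension _ (borelV R d) R (@borel_lebesgue R d).

Definition boundary (T : topologicalType) (D : set T) : set T :=
  closure D `\` D^°.

Section discrete_fourier.
Context (R : realType) (d : nat).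
Implicit Types (A B : 'M[R]_d) (N : 'M[int]_d) (x y : 'cV[R]_d).
Implicit Types (k j : 'cV[int]_d) (Omega : set 'cV[R]_d).

Definition intV k : 'cV[R]_d := map_mx intr k.

Definition tiles Omega A : Prop :=
  (forall x,
     (\esum_(k in [set: 'cV[int]_d]) (\1_Omega (x + A *m intV k) : R)%:E = 1)%E) /\
  (forall k j, k <> j ->
     [set x + A *m intV k | x in Omega] `&` [set x + A *m intV j | x in Omega]
     = set0).

Definition dot x y : R := (x^T *m y) 0 0.

Definition e2pi (t : R) : R[i] := (cos (2 * pi * t) +i* sin (2 * pi * t))%C.

Definition node B k : 'cV[R]_d := invmx B^T *m intV k.

(* With N = B^T A, Lambda_N is Lambda B OmegaA and Lambda_{N^T} is
   Lambda A OmegaB. *)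
Definition Lambda B Omega : set 'cV[int]_d := [set k | Omega (node B k)].

Definition phi A k x : R[i] := e2pi (((intV k)^T *m invmx A *m x) 0 0).

Definition phi_span A (L : set 'cV[int]_d) : set ('cV[R]_d -> R[i]) :=
  [set g | exists n (k : 'I_n -> 'cV[int]_d) (c : 'I_n -> R[i]),
     (forall i, L (k i)) /\ g = fun x => \sum_(i < n) c i * phi A (k i) x].

Definition fundamental A N OmegaB x : R[i] :=
  (`|\det N|%N)%:R^-1 * \sum_(j \in Lambda A OmegaB) phi A j x.

Definition interpolant A B N OmegaA OmegaB (f : 'cV[R]_d -> R[i]) x : R[i] :=
  \sum_(k \in Lambda B OmegaA)
    f (node B k) * fundamental A N OmegaB (x - node B k).

Definition Psi B OmegaB x : R[i] :=
  (`|\det B|^-1)%:C%C *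
  (Rintegral (lebesgueV R d) OmegaB (fun xi => cos (2 * pi * dot x xi)) +i*
   Rintegral (lebesgueV R d) OmegaB (fun xi => sin (2 * pi * dot x xi)))%C.

Definition box M (m : {ffun 'I_d -> 'I_M}) : set 'cV[int]_d :=
  [set k : 'cV[int]_d | forall i, (`|k i 0%R| <= m i)%N].

(* A family indexed by Z^d sums to s when the averages over all m in
   {0, ..., M}^d of its sums over the boxes |k_i| <= m_i tend to s as M goes to
   infinity (Cesaro summation in each coordinate). Psi decays only like a
   sinc, and the sums of Psi (x + A j) over growing cubes may diverge. *)
Definition lattice_sum (F : 'cV[int]_d -> R[i]) (s : R[i]) : Prop :=
  (fun M : nat => (M.+1 ^ d)%:R^-1 *
     \sum_(m : {ffun 'I_d -> 'I_M.+1}) \sum_(k \in box m) F k : R[i]^o)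
  @ \oo --> (s : R[i]^o).

End discrete_fourier.

(* Main.v *)
From HB Require Import structures.
Require Import Defs.
From mathcomp Require Import all_boot all_order all_algebra.
From mathcomp Require Import complex.
From mathcomp Require Import all_classical all_reals all_analysis.
From mathcomp Require Import measurable_realfun.
From mathcomp Require Import ring lra zify.
Import Order.TTheory GRing.Theory Num.Theory.
Import numFieldNormedType.Exports.

Set Implicit Arguments.
Unset Strict Implicit.
Unset Printing Implicit Defensive.

Local Open Scope classical_set_scope.
Local Open Scope ring_scope.

(** The interpolation statement is Fourier analysis on the finite group
    Z^d / N Z^d.  Since B^-T (N n) = A n, the nodes B^-T k and B^-T (k + N n)
    differ by a point of A Z^d, so a set that tiles with A Z^d selects exactly
    one k in each class modulo N Z^d: Lambda_N is a complete residue system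
    modulo N ([tiles_residues]), and for the same reason Lambda_(N^T) is one
    modulo N^T.  Smith's normal form counts such a system: it has |det N|
    elements ([card_residues]).  At the nodes the exponentials phi_l take the
    values e(l^T N^-1 k), that is, the values of the characters of
    Z^d / N Z^d.  The sum of a nontrivial character over a residue system
    vanishes ([character_sum]); the orthogonality relations over Lambda_(N^T)
    make the interpolant agree with f at the nodes ([interpolant_node]), and
    those over Lambda_N make interpolation reproduce each phi_l, hence every
    element of H_N, which is uniqueness ([interpolant_unique]).

    The formula for the fundamental function is Poisson summation in Cesaro
    form.  Summing e((x + A j).xi) over boxes and averaging gives e(x.xi) times
    the product over i of the Fejer kernels F_M at the coordinates of A^T xi
    ([cesaro_kernel]), so the Cesaro mean is |det B|^-1 times the integral over
    Omega_B of e(x.xi) against this product ([cesaro_mean]).  The parallelotopes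
    {xi | A^T xi - k in [-1/2, 1/2)^d} cut Omega_B into finitely many pieces, and
    on each of them the kernel is a density of total mass |det A|^-1
    ([integral_weight]) that concentrates at the lattice point A^-T k.  The
    integrand is continuous there, because no lattice point lies on the boundary
    of Omega_B; each piece therefore contributes |det A|^-1 e(x.A^-T k) if A^-T k
    is in Omega_B and 0 otherwise ([cvg_fejer_mean]).  With
    |det N| = |det A| |det B| the sum of these limits is the fundamental
    function.

    Concentration is proved by Korovkin's method ([cvg_weight]): on the k-th
    parallelotope the oscillation of the integrand is at most
    e + a sum_i (1 - cos (2 pi (A^T xi)_i)), and (1 - cos (2 pi t)) F_M(t) is at
    most 2 / (M + 1) ([fejer_cos]), so no other estimate on the kernel is needed.
    The constant |det A|^-1 comes from the change of variables formula for affine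
    maps ([affine_change_unit]), proved by Fubini's theorem for block triangular
    matrices and by a factorisation into such matrices. *)

(** * Residue systems of Z^d modulo an integer matrix *)

(** The uniqueness clause asks for n = 0 and not only for N n = 0: this is what
    tilings give, and it spares appeals to the injectivity of N. *)
Definition residues d (N : 'M[int]_d) (C : set 'cV[int]_d) : Prop :=
  (forall j, exists n, C (j + N *m n)) /\
  (forall k n, C k -> C (k + N *m n) -> n = 0).

Lemma modz_eqD (a b e : int) : (a %% e)%Z = (b %% e)%Z ->
  b = a + e * ((b %/ e)%Z - (a %/ e)%Z).
Proof.
move=> abe; rewrite mulrBr [e * (b %/ e)%Z]mulrC [e * (a %/ e)%Z]mulrC.
have /eqP := divz_eq b e; rewrite -abe -subr_eq => /eqP <-.
by have /eqP := divz_eq a e; rewrite addrC -subr_eq => /eqP {1}<-; ring.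
Qed.

(** In the Smith form N = L D R with D = diag(e_1, ..., e_d), the map sending k
    to the residues of the coordinates of L^-1 k modulo the e_i identifies [C]
    with the product of the Z / e_i, which has |e_1 ... e_d| = |det N| elements
    because det L and det R are 1 or -1. *)
Lemma card_residues d (N : 'M[int]_d) (C : set 'cV[int]_d) :
  \det N != 0 -> residues N C -> (C #= `I_(`|\det N|%N))%card.
Proof.
move=> detN [Cex Cuniq].
have [L uL [R uR [e' _ defN]]] := int_Smith_normal_form N.
pose e (i : 'I_d) : int := e'`_i.
pose D : 'M[int]_d := diag_mx (\row_i e i).
have {}defN : N = L *m D *m R.
  rewrite defN; congr (_ *m _ *m _); apply/matrixP => i j.
  by rewrite !mxE -val_eqE.
have detD : \det D = \prod_(i < d) e i.
  by rewrite det_diag; apply: eq_bigr => i _; rewrite mxE.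
have unit1 (M : 'M[int]_d) : M \in unitmx -> `|\det M|%N = 1%N.
  rewrite unitmxE => /unitrP[x [/(congr1 absz)]]; rewrite abszM => /eqP + _.
  by rewrite muln_eq1 => /andP[_ /eqP].
have detNe : `|\det N|%N = (\prod_(i < d) `|e i|)%N.
  rewrite defN !det_mulmx !abszM (unit1 _ uL) (unit1 _ uR) mul1n muln1 detD.
  exact: (big_morph absz abszM (erefl _ : `|1|%N = 1%N)).
have e_gt0 i : (0 < `|e i|)%N.
  rewrite lt0n; apply: contraNneq detN => ei0.
  by rewrite -absz_eq0 detNe (bigD1 i)//= ei0 mul0n.
pose G : finType := {dffun forall i : 'I_d, 'I_(`|e i|%N)}.
have cardG : #|G| = `|\det N|%N.
  rewrite card_dep_ffun detNe /image_mem foldrE big_map enumT.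
  by apply: eq_bigr => i _; rewrite card_ord.
have modP (k : 'cV[int]_d) (i : 'I_d) :
    (`|((invmx L *m k) i 0%R %% e i)%Z| < `|e i|)%N.
  have e0 : e i != 0 by rewrite -absz_gt0.
  by rewrite -ltz_nat gez0_abs ?modz_ge0// ltz_mod.
pose q (k : 'cV[int]_d) : G := finfun (fun i => Ordinal (modP k i)).
have qP (k s : 'cV[int]_d) : (forall i, q k i = q s i) -> exists n, s = k + N *m n.
  move=> ks.
  pose z : 'cV[int]_d :=
    \col_i (((invmx L *m s) i 0%R %/ e i)%Z - ((invmx L *m k) i 0%R %/ e i)%Z).
  exists (invmx R *m z); rewrite defN -!mulmxA mulKVmx//.
  rewrite -{1}(mulKVmx uL s) -{1}(mulKVmx uL k) -mulmxDr; congr (_ *m _).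
  apply/colP => i; rewrite mul_diag_mx [RHS]mxE [X in _ = _ + X]mxE.
  rewrite [(\row__ _) _ _]mxE [z i 0]mxE.
  have := ks i; rewrite !ffunE => /(congr1 val) /= /(congr1 Posz).
  have e0 : e i != 0 by rewrite -absz_gt0.
  rewrite !gez0_abs ?modz_ge0// => kse.
  exact: modz_eqD kse.
rewrite -cardG.
apply/card_set_bijP; exists (fun k => val (enum_rank (q k))); split.
- by move=> k _ /=; exact: ltn_ord.
- move=> k s /set_mem Ck /set_mem Cs /val_inj/enum_rank_inj kse.
  have [i|n sE] := qP k s; first by rewrite kse.
  by rewrite sE in Cs *; rewrite (Cuniq _ _ Ck Cs) mulmx0 addr0.
- move=> m /= mG; pose g : G := enum_val (Ordinal mG).
  pose s : 'cV[int]_d := \col_i (g i : nat)%:Z.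
  have [n Cn] := Cex (L *m s); exists (L *m s + N *m n) => //.
  suff -> : q (L *m s + N *m n) = g by rewrite enum_valK.
  apply/ffunP => i; rewrite ffunE; apply: val_inj => /=.
  rewrite mulmxDr mulKmx// defN -!mulmxA mulKmx// mxE mul_diag_mx mxE.
  rewrite [X in (_ + X)%R]mxE [(\row__ _) _ _]mxE.
  rewrite addrC mulrC modzMDl -modz_abs modz_small ?absz_nat//.
  by rewrite abszE ltz_nat ltn_ord.
Qed.

(** * Exponentials *)

Section e2pi.
Variable R : realType.
Implicit Types s t : R.

Lemma e2piD s t : e2pi (s + t) = e2pi s * e2pi t.
Proof.
rewrite /e2pi mulrDr cosD sinD; apply/eqP; rewrite eq_complex /=.
by rewrite eqxx /= addrC.
Qed.

Lemma e2pi0 : e2pi 0 = 1 :> R[i].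
Proof. by rewrite /e2pi mulr0 cos0 sin0. Qed.

Lemma e2pi1 : e2pi 1 = 1 :> R[i].
Proof. by rewrite /e2pi mulr1 mulr_natl cos2pi sin2pi. Qed.

Lemma e2pi_int (k : int) : e2pi k%:~R = 1 :> R[i].
Proof.
have nat1 (n : nat) : e2pi n%:R = 1 :> R[i].
  by elim: n => [|n IHn]; rewrite ?e2pi0// -natr1 e2piD IHn e2pi1 mulr1.
case: k => [n|n]; first by rewrite -pmulrn nat1.
have := e2piD n.+1%:R (- n.+1%:R); rewrite subrr e2pi0 nat1 mul1r => ->.
by rewrite NegzE mulrNz.
Qed.

(** The period of [e2pi] is exactly 1, since sin (pi f) > 0 on (0, 1). *)
Lemma e2pi_eq1 t : e2pi t = 1 -> t \is a Num.int.
Proof.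
move=> t1; set f := t - (Num.floor t)%:~R.
have f1 : e2pi f = 1 by rewrite /f -mulrNz e2piD t1 e2pi_int mulr1.
have f0 : 0 <= f by rewrite subr_ge0 ge_floor.
have fl1 : f < 1 by rewrite ltrBlDl -[X in _ + X]/(1%:~R) -intrD floorD1_gt.
have [fE|fn0] := eqVneq f 0.
  by move/eqP : fE; rewrite subr_eq0 => /eqP ->; exact: intr_int.
have pi0 := pi_gt0 R.
have f_gt0 : 0 < f by rewrite lt0r fn0.
have : 0 < sin (pi * f) by apply: sin_gt0_pi; rewrite mulr_gt0//= gtr_pMr.
move: f1 => [+ _]; rewrite -mulrA mulr_natl cos_mulr2n cos2sin2 => c1 s0.
suff : sin (pi * f) ^+ 2 = 0 by move/eqP; rewrite sqrf_eq0 gt_eqF.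
by move: c1; lra.
Qed.

End e2pi.

(** * Lattice tilings give residue systems *)

Section tilings.
Variables (R : realType) (d : nat).
Implicit Types (A B : 'M[R]_d) (N : 'M[int]_d) (k j : 'cV[int]_d).

Lemma intVD k j : intV R (k + j) = intV R k + intV R j.
Proof. exact: map_mxD. Qed.

Lemma intVM N k : intV R (N *m k) = map_mx intr N *m intV R k.
Proof. exact: map_mxM. Qed.

Lemma intV_inj : injective (@intV R d).
Proof.
move=> k j /matrixP kj; apply/matrixP => i l; apply: (@intr_inj R).
by have := kj i l; rewrite !mxE.
Qed.

Lemma nodeD A k j : node A (k + j) = node A k + node A j.
Proof. by rewrite /node intVD mulmxDr. Qed.

Lemma node_period A B N j : B \in unitmx -> map_mx intr N = B^T *m A ->
  node B (N *m j) = A *m intV R j.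
Proof. by move=> uB NE; rewrite /node intVM NE -mulmxA mulKmx ?unitmx_tr. Qed.

(** Replacing j by j + N n translates the node of j by A n.  Existence then holds
    because the indicators of the translates sum to 1, and uniqueness because the
    translates are disjoint. *)
Lemma tiles_residues A B N (Omega : set 'cV[R]_d) : B \in unitmx ->
  map_mx intr N = B^T *m A -> tiles Omega A -> residues N (Lambda B Omega).
Proof.
move=> uB NE [sum1 disj]; split.
- move=> j; apply: contrapT => noN.
  have := sum1 (node B j); rewrite esum1 => [/esym/eqP|n _].
    by rewrite onee_eq0.
  have noO : ~ Omega (node B j + A *m intV R n).
    by move=> On; apply: noN; exists n; rewrite /Lambda/= nodeD (node_period _ uB NE).
  by rewrite indicE memNset.
- move=> k n; rewrite /Lambda/= nodeD (node_period _ uB NE) => Ok Okn.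
  apply: contrapT => n0; have := disj n 0 n0.
  move/seteqP => [+ _] => /(_ (node B k + A *m intV R n)); apply; split.
    by exists (node B k).
  exists (node B k + A *m intV R n) => //.
  by rewrite /intV map_mx0 mulmx0 addr0.
Qed.

End tilings.

(** * Characters of Z^d / N Z^d *)

Section characters.
Variables (R : realType) (d : nat).
Implicit Types (A B : 'M[R]_d) (N : 'M[int]_d) (k j : 'cV[int]_d).

(** The duality between Z^d / N^T Z^d and Z^d / N Z^d, with values modulo 1. *)
Definition pairing N k j : R :=
  ((intV R k)^T *m invmx (map_mx intr N) *m intV R j) 0 0.

Lemma pairing_tr N k j : pairing N^T j k = pairing N k j.
Proof.
transitivity (((intV R k)^T *m invmx (map_mx intr N) *m intV R j)^T 0 0).
  by rewrite /pairing !trmx_mul trmxK trmx_inv mulmxA (map_trmx _ N).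
by rewrite mxE.
Qed.

Lemma pairingDl N k k' j : pairing N (k + k') j = pairing N k j + pairing N k' j.
Proof. by rewrite /pairing intVD raddfD/= !mulmxDl mxE. Qed.

Lemma pairingDr N k j j' : pairing N k (j + j') = pairing N k j + pairing N k j'.
Proof. by rewrite /pairing intVD !mulmxDr mxE. Qed.

Lemma pairingNr N k j : pairing N k (- j) = - pairing N k j.
Proof. by rewrite /pairing /intV map_mxN mulmxN mxE. Qed.

Lemma pairingNl N k j : pairing N (- k) j = - pairing N k j.
Proof. by rewrite /pairing /intV map_mxN raddfN /= !mulNmx mxE. Qed.

Lemma unit_intmx N : \det N != 0 -> (map_mx intr N : 'M[R]_d) \in unitmx.
Proof. by move=> detN; rewrite unitmxE det_map_mx unitfE intr_eq0. Qed.

Lemma pairing_intr N k n : \det N != 0 -> pairing N k (N *m n) \is a Num.int.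
Proof.
move=> detN.
have uN := unit_intmx detN.
rewrite /pairing intVM -mulmxA mulKmx// mxE rpred_sum// => i _.
by rewrite !mxE rpredM ?intr_int.
Qed.

Lemma pairing_intl N k n : \det N != 0 -> pairing N (N^T *m n) k \is a Num.int.
Proof. by move=> detN; rewrite -pairing_tr pairing_intr ?det_tr. Qed.

Lemma residues_sum_shift N C (V : nmodType) (w : 'cV[int]_d -> V) k0 :
  residues N C -> (forall k n, w (k + N *m n) = w k) ->
  \sum_(k \in C) w (k + k0) = \sum_(k \in C) w k.
Proof.
move=> [Cex Cuniq] wN; have [nu nuP] := choice Cex.
pose h k := k + k0 + N *m nu (k + k0).
rewrite [RHS](reindex_fsbig h C C); first by apply: eq_fsbigr => k _; rewrite /h wN.
split.
- by move=> k _; exact: nuP.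
- move=> k k' /set_mem Ck /set_mem Ck'; rewrite /h => kk'.
  suff k'E : k' = k + N *m (nu (k + k0) - nu (k' + k0)).
    by rewrite k'E in Ck' *; rewrite (Cuniq _ _ Ck Ck') mulmx0 addr0.
  apply: (addIr (k0 + N *m nu (k' + k0))); rewrite addrA -kk' mulmxBr.
  by rewrite !addrA (addrAC _ _ k0) addrNK addrAC.
- move=> c Cc; pose m := nu (c - k0); exists (c - k0 + N *m m); first exact: nuP.
  have := nuP (c - k0 + N *m m + k0); rewrite /h.
  rewrite (addrAC _ _ k0) subrK -addrA -mulmxDr => Cc'.
  by rewrite (Cuniq _ _ Cc Cc') mulmx0 addr0.
Qed.

(** A shift of k by the l-th unit vector leaves the sum unchanged and multiplies
    it by [e2pi] of the l-th entry of N^-1 j.  If some entry is not an integer,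
    this factor is not 1 and the sum vanishes; otherwise j is in N Z^d and all
    terms are 1. *)
Lemma character_sum N C j : \det N != 0 -> residues N^T C ->
  \sum_(k \in C) e2pi (pairing N k j) =
  if `[< exists n, j = N *m n >] then (`|\det N|%N)%:R else 0 :> R[i].
Proof.
move=> detN resC.
have detN' : \det N^T != 0 by rewrite det_tr.
have cardC := card_residues detN' resC.
have finC : finite_set C by exists (`|\det N^T|%N).
case: asboolP => [[n ->]|noN].
  under eq_fsbigr => k _.
    have /intrP[m ->] := pairing_intr k n detN; rewrite e2pi_int.
    over.
  rewrite fsbig_finite//= big_const_seq count_predT.
  by rewrite -det_tr -(card_fset_set cardC) iter_addr addr0.
have uN := unit_intmx detN.
have [l lN] : exists l : 'I_d, ~ pairing N (delta_mx l 0) j \is a Num.int.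
  apply: contrapT => allint.
  have {}allint l : pairing N (delta_mx l 0) j \is a Num.int.
    by apply: contrapT => lN; apply: allint; exists l.
  apply: noN; exists (\col_l Num.floor (pairing N (delta_mx l 0) j)).
  apply: (@intV_inj R); rewrite intVM -[LHS](mulKVmx uN); congr (_ *m _).
  apply/colP => l; have := allint l; rewrite intrEfloor => /eqP lE.
  rewrite [RHS]mxE [X in _ = intr X]mxE lE /pairing -mulmxA.
  have -> : intV R (delta_mx l 0) = delta_mx l 0.
    by apply/matrixP => a b; rewrite !mxE; case: (_ && _).
  by rewrite trmx_delta -rowE [RHS]mxE.
set S := \sum_(k \in C) _.
have SE : S = e2pi (pairing N (delta_mx l 0) j) * S.
  rewrite {1}/S -(residues_sum_shift (delta_mx l 0) resC) => [|k n].
    rewrite /S !fsbig_finite//= mulr_sumr; apply: eq_bigr => k _.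
    by rewrite pairingDl e2piD mulrC.
  have /intrP[m mE] := pairing_intl j n detN.
  by rewrite pairingDl mE e2piD e2pi_int mulr1.
apply/eqP; rewrite -[_ == 0]orFb.
have <- : (1 - e2pi (pairing N (delta_mx l 0) j) == 0) = false.
  by apply/negP; rewrite subr_eq0 eq_sym => /eqP/e2pi_eq1.
by rewrite -mulf_eq0 mulrBl mul1r -SE subrr.
Qed.

Lemma character_orthogonality N C C' j k : \det N != 0 -> residues N C ->
  residues N^T C' -> C j -> C k ->
  \sum_(l \in C') e2pi (pairing N l (j - k)) =
  (`|\det N|%N)%:R * (j == k)%:R :> R[i].
Proof.
move=> detN [_ Cuniq] resC' Cj Ck; rewrite character_sum//.
case: asboolP => [[n jkn]|noN]; last first.
  have [jk|] := eqVneq j k; last by rewrite mulr0.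
  by case: noN; exists 0; rewrite jk subrr mulmx0.
have jE : j = k + N *m n by rewrite -jkn addrC subrK.
by rewrite jE in Cj *; rewrite (Cuniq _ _ Ck Cj) mulmx0 addr0 eqxx mulr1.
Qed.

End characters.

(** * Trigonometric interpolation *)

Lemma fsbig_delta (T : choiceType) (V : nmodType) (P : set T) (F : T -> V) j :
  P j -> (forall k, P k -> k != j -> F k = 0) -> \sum_(k \in P) F k = F j.
Proof.
move=> Pj F0; rewrite -(@fsbig_widen _ _ _ _ [set j]) ?fsbig_set1//.
  by move=> _ ->.
by move=> k [Pk /eqP]; exact: F0.
Qed.

Section interpolation.
Variables (R : realType) (d : nat) (A B : 'M[R]_d) (N : 'M[int]_d).
Variables (OmegaA OmegaB : set 'cV[R]_d).
Hypotheses (uA : A \in unitmx) (uB : B \in unitmx).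
Hypothesis NE : map_mx intr N = B^T *m A.
Hypotheses (tilA : tiles OmegaA A) (tilB : tiles OmegaB B).
Implicit Types (f g : 'cV[R]_d -> R[i]) (k j l : 'cV[int]_d).

Local Notation C := (Lambda B OmegaA).
Local Notation C' := (Lambda A OmegaB).
Local Notation I := (interpolant A B N OmegaA OmegaB).

Let resC : residues N C.
Proof. exact: tiles_residues tilA. Qed.

Let resC' : residues N^T C'.
Proof.
by apply: tiles_residues tilB => //; rewrite -map_trmx NE trmx_mul trmxK.
Qed.

Let detN : \det N != 0.
Proof.
by rewrite -(@intr_eq0 R) -det_map_mx NE -unitfE -unitmxE unitmx_mul unitmx_tr uB.
Qed.

Let cardC : (C #= `I_(`|\det N|%N))%card.
Proof. exact: card_residues. Qed.

Let cardC' : (C' #= `I_(`|\det N|%N))%card.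
Proof. by rewrite -det_tr; apply: card_residues; rewrite ?det_tr. Qed.

Let finC : finite_set C. Proof. by exists (`|\det N|%N). Qed.

Let finC' : finite_set C'. Proof. by exists (`|\det N|%N). Qed.

Let normN_neq0 : (`|\det N|%N)%:R != 0 :> R[i].
Proof. by rewrite pnatr_eq0 absz_eq0. Qed.

Lemma phiD k x y : phi A k (x + y) = phi A k x * phi A k y.
Proof. by rewrite /phi mulmxDr mxE e2piD. Qed.

Lemma phi_node k j : phi A k (node B j) = e2pi (pairing R N k j).
Proof.
rewrite /phi /pairing /node; congr (e2pi (fun_of_matrix _ 0 0)).
rewrite -!mulmxA; congr (_ *m _); apply: (can_inj (mulKmx (unit_intmx R detN))).
by rewrite mulKVmx ?unit_intmx// NE -mulmxA !mulKVmx// unitmx_tr.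
Qed.

Lemma nodeN j : node B (- j) = - node B j.
Proof. by rewrite /node /intV map_mxN mulmxN. Qed.

Lemma interpolantE f x : I f x = \sum_(l \in C')
   ((`|\det N|%N)%:R^-1 * \sum_(k \in C) f (node B k) * phi A l (- node B k)) *
   phi A l x.
Proof.
rewrite /interpolant /fundamental !fsbig_finite//=.
under eq_bigr => k _ do rewrite fsbig_finite//= mulrCA mulr_sumr mulr_sumr.
rewrite exchange_big/=; apply: eq_bigr => l _.
rewrite fsbig_finite//= mulr_sumr mulr_suml; apply: eq_bigr => k _.
by rewrite phiD; ring.
Qed.

Lemma phi_span_interpolant f : phi_span A C' (I f).
Proof.
pose s : seq 'cV[int]_d := finmap.enum_fset (fset_set C').
have sC (i : 'I_(size s)) : C' s`_i.
  by have := mem_nth 0 (ltn_ord i); rewrite in_fset_set// inE.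
pose c l : R[i] :=
  (`|\det N|%N)%:R^-1 * \sum_(k \in C) f (node B k) * phi A l (- node B k).
exists (size s), (fun i => s`_i), (fun i => c s`_i); split => //.
apply/funext => x; rewrite interpolantE fsbig_finite//=.
by rewrite (big_nth 0) big_mkord.
Qed.

Lemma interpolant_node f j : C j -> I f (node B j) = f (node B j).
Proof.
move=> Cj; have fundE k : C k ->
    fundamental A N OmegaB (node B j - node B k) = (j == k)%:R.
  move=> Ck; rewrite /fundamental -nodeN -nodeD.
  under eq_fsbigr do rewrite phi_node.
  by rewrite (character_orthogonality _ detN resC resC')// mulKf.
rewrite /interpolant (fsbig_delta Cj) => [|k Ck kj].
  by rewrite fundE// eqxx mulr1.
by rewrite fundE// eq_sym (negbTE kj) mulr0.
Qed.

(** Orthogonality over the nodes, that is, over a residue system modulo N: the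
    roles of N and N^T are exchanged with respect to [interpolant_node]. *)
Lemma interpolant_phi l : C' l -> I (phi A l) = phi A l.
Proof.
move=> C'l; apply/funext => x; rewrite interpolantE.
have ortho l' : C' l' ->
    \sum_(k \in C) phi A l (node B k) * phi A l' (- node B k) =
    (`|\det N|%N)%:R * (l == l')%:R.
  move=> C'l'; have resTT : residues N^T^T C by rewrite trmxK.
  rewrite -[in RHS]det_tr -(character_orthogonality _ _ resC' resTT) ?det_tr//.
  apply: eq_fsbigr => k _; rewrite pairing_tr -nodeN !phi_node -e2piD.
  by rewrite pairingNr pairingDl pairingNl.
rewrite (fsbig_delta C'l) => [|l' C'l' ll']; rewrite ortho//.
  by rewrite eqxx mulr1 mulVf// mul1r.
by rewrite eq_sym (negbTE ll') !mulr0 mul0r.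
Qed.

(** By linearity an element of the span is the interpolant of its own values, and
    the interpolant depends only on the values at the nodes. *)
Lemma interpolant_unique f g : phi_span A C' g ->
  (forall j, C j -> g (node B j) = f (node B j)) -> g = I f.
Proof.
move=> [n [k [c [kC' gE]]]] gf; transitivity (I g).
  apply/funext => x; rewrite {2}gE interpolantE.
  under eq_fsbigr => l _.
    rewrite fsbig_finite//=.
    under eq_bigr => j _ do rewrite mulr_suml.
    rewrite exchange_big/= mulr_sumr mulr_suml.
    over.
  rewrite fsbig_finite//= exchange_big/= gE; apply: eq_bigr => i _.
  rewrite -[in LHS](interpolant_phi (kC' i)) interpolantE fsbig_finite//= mulr_sumr.
  apply: eq_bigr => l _; rewrite fsbig_finite//= !mulr_sumr mulr_suml mulr_suml mulr_sumr.
  by apply: eq_bigr => j _; ring.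
by apply/funext => x; apply: eq_fsbigr => j /[!inE] Cj; rewrite gf.
Qed.

End interpolation.

(** * Affine change of variables for Lebesgue measure *)

Section affine_line.
Variable R : realType.
Notation leb := (@lebesgue_measure R).

Lemma measurable_affine (a b : R) :
  measurable_fun setT (fun t : measurableTypeR R => a * t + b : measurableTypeR R).
Proof. by apply: measurable_funD => //; exact: mulrl_measurable. Qed.

Lemma lebesgue_measure_affine (a b : R) (X : set (measurableTypeR R)) :
  a != 0 -> ocitv X ->
  leb X = (`|a|%:E * leb [set t | X (a * t + b)%R])%E.
Proof.
move=> a0 [[x y]/= _ <-]; rewrite lebesgue_measure_itv/= lte_fin.
have [a_lt0|a_gt0|a00] := ltgtP a 0; last by rewrite a00 eqxx in a0.
- rewrite (_ : [set t | _] = `[((y - b) / a)%R, ((x - b) / a)%R[%classic); last first.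
    apply/seteqP; split => t /=; rewrite !in_itv/= => /andP[h1 h2]; apply/andP; split.
    + by rewrite ler_ndivrMr// mulrC; lra.
    + by rewrite ltr_ndivlMr// mulrC; lra.
    + by move: h2; rewrite ltr_ndivlMr// mulrC; lra.
    + by move: h1; rewrite ler_ndivrMr// mulrC; lra.
  rewrite lebesgue_measure_itv/= lte_fin ltr_nM2r ?invr_lt0// ltrD2r.
  case: ifP => _; last by rewrite mule0.
  by rewrite -EFinB -EFinM ltr0_norm//; congr EFin; field.
- rewrite (_ : [set t | _] = `]((x - b) / a)%R, ((y - b) / a)%R]%classic); last first.
    apply/seteqP; split => t /=; rewrite !in_itv/= => /andP[h1 h2]; apply/andP; split.
    + by rewrite ltr_pdivrMr// mulrC; lra.
    + by rewrite ler_pdivlMr// mulrC; lra.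
    + by move: h1; rewrite ltr_pdivrMr// mulrC; lra.
    + by move: h2; rewrite ler_pdivlMr// mulrC; lra.
  rewrite lebesgue_measure_itv/= lte_fin ltr_pM2r ?invr_gt0// ltrD2r.
  case: ifP => _; last by rewrite mule0.
  by rewrite -EFinB -EFinM gtr0_norm//; congr EFin; field.
Qed.

Lemma integral_affine_line (a b : R) (f : measurableTypeR R -> \bar R) :
  a != 0 -> measurable_fun setT f -> (forall x, 0 <= f x)%E ->
  (\int[leb]_t f (a * t + b)%R = `|a|^-1%:E * \int[leb]_t f t)%E.
Proof.
move=> a0 mf f0.
have mphi := measurable_affine a b.
pose phi (t : measurableTypeR R) : measurableTypeR R := a * t + b.
pose nu : {measure set (measurableTypeR R) -> \bar R} :=
  mscale (NngNum (normr_ge0 a)) (pushforward leb phi).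
have -> : (\int[leb]_t f t = `|a|%:E * \int[leb]_t f (a * t + b)%R)%E.
  rewrite (@eq_measure_integral _ _ _ setT (nu mphi) leb).
    rewrite ge0_integral_mscale//; congr (_ * _)%E.
    by rewrite ge0_integral_pushforward// preimage_setT.
  move=> X mX _; apply: lebesgue_measure_unique => // Y oY.
  by rewrite (lebesgue_measure_affine b a0 oY).
by rewrite muleA -EFinM mulVf ?normr_eq0// mul1e.
Qed.

End affine_line.

Section affine_space.
Variable R : realType.
Notation leb := (@lebesgue_measure R).
Notation mu := (borel_lebesgue R).

Lemma integral_borelV_prod d (f : borelV R d.+1 -> \bar R) :
  measurable_fun setT f -> (forall x, 0 <= f x)%E ->
  (\int[mu d.+1]_x f x = \int[leb \x mu d]_z f (consV z))%E.
Proof.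
move=> mf f0.
by rewrite -(preimage_setT (@consV R d)) -ge0_integral_pushforward//;
  exact: measurable_consV.
Qed.

Lemma integral_borelV1 d (f : borelV R d.+1 -> \bar R) :
  measurable_fun setT f -> (forall x, 0 <= f x)%E ->
  (\int[mu d.+1]_x f x = \int[leb]_t \int[mu d]_y f (consV (t, y)))%E.
Proof.
move=> mf f0; rewrite integral_borelV_prod// fubini_tonelli1//.
exact: (measurableT_comp mf (@measurable_consV R d)).
Qed.

Lemma integral_borelV2 d (f : borelV R d.+1 -> \bar R) :
  measurable_fun setT f -> (forall x, 0 <= f x)%E ->
  (\int[mu d.+1]_x f x = \int[mu d]_y \int[leb]_t f (consV (t, y)))%E.
Proof.
move=> mf f0; rewrite integral_borelV_prod// fubini_tonelli2//.
exact: (measurableT_comp mf (@measurable_consV R d)).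
Qed.

Lemma measurable_affineV d d' (L : 'M[R]_(d', d)) (b : 'cV[R]_d') :
  measurable_fun setT (fun x : borelV R d => (L *m x + b)%R : borelV R d').
Proof.
apply: measurable_funV => i; under eq_fun do rewrite !mxE.
apply: measurable_funD => //; apply: measurable_sum => j.
by apply: measurable_funM => //; exact: measurable_coordV.
Qed.

Definition affine_change d (L : 'M[R]_d) : Prop :=
  forall (b : 'cV[R]_d) (f : borelV R d -> \bar R),
    measurable_fun setT f -> (forall x, 0 <= f x)%E ->
    (\int[mu d]_x f (L *m x + b)%R = (`|\det L|^-1)%:E * \int[mu d]_x f x)%E.

Lemma affine_change_mul d (L1 L2 : 'M[R]_d) :
  affine_change L1 -> affine_change L2 -> affine_change (L1 *m L2).
Proof.
move=> c1 c2 b f mf f0.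
under eq_integral do rewrite -mulmxA -[(L2 *m _)%R]addr0.
rewrite (c2 0%R (fun x => f (L1 *m x + b)%R))//; last first.
  exact: (measurableT_comp mf (measurable_affineV L1 b)).
by rewrite c1// muleA -EFinM det_mulmx normrM invfM mulrC.
Qed.

Lemma consVE d (t : R) (y : 'cV[R]_d) :
  consV (t, y) = (col_mx (t%:M : 'M[R]_1) y : 'cV[R]_(1 + d)).
Proof.
apply/colP => i; rewrite !mxE; case: split_ordP => j ->.
  by rewrite ord1 (_ : lshift d ord0 = 0) ?unlift_none ?mxE ?eqxx//; exact: val_inj.
by rewrite (_ : rshift 1 j = lift 0 j) ?liftK//; exact: val_inj.
Qed.

(** The first coordinate of the image involves only the first variable, so the
    other d variables are integrated first. *)
Lemma affine_change_lblock d (a : R) (c : 'cV[R]_d) (L : 'M[R]_d) :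
  a != 0 -> affine_change L -> affine_change (block_mx a%:M 0 c L : 'M[R]_(1 + d))%R.
Proof.
move=> a0 cL b f mf f0.
have mfc := measurableT_comp mf (@measurable_consV R d).
have mfL := measurableT_comp mf (measurable_affineV (block_mx a%:M 0 c L : 'M[R]_(1 + d))%R b).
rewrite integral_borelV1// det_lblock det_scalar1 normrM invfM.
have E t y : (block_mx a%:M 0 c L *m consV (t, y) + b)%R =
    consV ((a * t + b 0 0)%R, (L *m y + (t *: c + dsubmx (b : 'cV[R]_(1 + d))))%R).
  rewrite !consVE mul_block_col mul0mx addr0 -{1}(vsubmxK (b : 'cV[R]_(1 + d))) add_col_mx.
  congr col_mx; last by rewrite mul_mx_scalar addrA [(L *m y + _)%R]addrC.
  rewrite -scalar_mxM [usubmx _]mx11_scalar -raddfD /=; congr ((_ + _)%R%:M).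
  by rewrite mxE; congr (b _ _); exact: val_inj.
under eq_integral => t _.
  under eq_integral do rewrite E.
  rewrite (cL _ (fun y => f (consV ((a * t + b 0 0)%R, y))))//; last first.
    exact: (measurableT_comp mfc (measurable_pair1 _)).
  over.
have mF := measurable_fun_fubini_tonelli_F (m2 := mu d) _ mfc (fun z => f0 _).
rewrite ge0_integralZl//; last 2 first.
- exact: (measurableT_comp mF (measurable_affine a (b 0 0))).
- by move=> t _; exact: integral_ge0.
rewrite (integral_affine_line (b 0 0) a0 mF); last first.
  by move=> t; apply: integral_ge0 => ? _; exact: f0.
by rewrite integral_borelV1// muleA -EFinM [(_^-1 * _)%R]mulrC.
Qed.

(** The last d coordinates of the image do not involve the first variable, which
    is therefore integrated first. *)
Lemma affine_change_ublock d (a : R) (r : 'rV[R]_d) (L : 'M[R]_d) :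
  a != 0 -> affine_change L -> affine_change (block_mx a%:M r 0 L : 'M[R]_(1 + d)).
Proof.
move=> a0 cL b f mf f0.
have mfc := measurableT_comp mf (@measurable_consV R d).
have mfL := measurableT_comp mf (measurable_affineV (block_mx a%:M r 0 L : 'M[R]_(1 + d)) b).
rewrite integral_borelV2// det_ublock det_scalar1 normrM invfM.
have E t y : (block_mx a%:M r 0 L *m consV (t, y) + b)%R =
    consV ((a * t + ((r *m y) 0 0 + b 0 0))%R, (L *m y + dsubmx (b : 'cV[R]_(1 + d)))%R).
  rewrite !consVE mul_block_col mul0mx add0r -{1}(vsubmxK (b : 'cV[R]_(1 + d))) add_col_mx.
  congr col_mx; rewrite -scalar_mxM [usubmx _]mx11_scalar [r *m y]mx11_scalar.
  rewrite -!raddfD /= -addrA; congr ((_ + (_ + _))%R%:M).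
    by rewrite !mxE eqxx mulr1n.
  by rewrite mxE; congr (b _ _); exact: val_inj.
under eq_integral => y _.
  under eq_integral do rewrite E.
  rewrite (integral_affine_line _ a0
    (f := fun t => f (consV (t, (L *m y + dsubmx (b : 'cV[R]_(1 + d)))%R))))//; last first.
    exact: (measurableT_comp mfc (measurable_pair2 _)).
  over.
have mG := measurable_fun_fubini_tonelli_G (m1 := leb) _ mfc (fun z => f0 _).
rewrite ge0_integralZl//; last 2 first.
- exact: (measurableT_comp mG (measurable_affineV L _)).
- by move=> t _; exact: integral_ge0.
rewrite (cL _ (fun y => \int[leb]_t f (consV (t, y)))%E)//; last first.
  by move=> t; apply: integral_ge0 => ? _; exact: f0.
by rewrite integral_borelV2// muleA -EFinM.
Qed.

(** Any invertible matrix of size 1 + d factors as an upper, a lower and an upper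
    block triangular one: a transvection makes the corner entry nonzero, and then
    the Schur complement of that entry is invertible. *)
Lemma affine_change_unit d (L : 'M[R]_d) : L \in unitmx -> affine_change L.
Proof.
elim: d L => [|d IHd].
  move=> L uL.
  move=> b f mf f0; rewrite det_mx00 normr1 invr1 mul1e.
  by apply: eq_integral => x _; rewrite [(_ + _)%R]flatmx0 [x in RHS]flatmx0.
change (forall L : 'M[R]_(1 + d), L \in unitmx -> affine_change L) => L uL.
have id1 : affine_change (1%:M : 'M[R]_d) by apply: IHd; exact: unitmx1.
have corner (M : 'M[R]_(1 + d)) : M \in unitmx -> ulsubmx M 0 0 != 0 -> affine_change M.
  move=> uM; set a := ulsubmx M 0 0 => a0.
  pose S := drsubmx M - a^-1 *: (dlsubmx M *m ursubmx M).
  have ME : M = (block_mx 1%:M 0 (a^-1 *: dlsubmx M) 1%:M : 'M[R]_(1 + d)) *m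
                (block_mx a%:M (ursubmx M) 0 S : 'M[R]_(1 + d)).
    rewrite mulmx_block !mul1mx !mul0mx !addr0 -!scalemxAl mul_mx_scalar.
    rewrite scalerA mulVf// scale1r addrC subrK /a -mx11_scalar.
    by rewrite submxK.
  rewrite ME; apply: affine_change_mul.
    by apply: affine_change_lblock => //; exact: oner_neq0.
  apply: affine_change_ublock => //; apply: IHd.
  move: uM; rewrite ME unitmx_mul => /andP[_].
  by rewrite !unitmxE det_ublock unitrM => /andP[].
have [a0|] := eqVneq (ulsubmx L 0 0) 0; last exact: corner.
have [c0|/matrix0Pn[i [j cij]]] := eqVneq (dlsubmx L) 0.
  move: uL; rewrite -(submxK L) c0 [ulsubmx _]mx11_scalar a0.
  by rewrite unitmxE det_ublock det_scalar1 mul0r unitr0.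
pose U (s : R) : 'M[R]_(1 + d) := block_mx 1%:M (s *: delta_mx 0 i) 0 1%:M.
have UV : U (-1) *m U 1 = 1%:M.
  rewrite mulmx_block !mul1mx !mul0mx !mulmx0 !mulmx1 !addr0 !add0r scaleN1r scale1r.
  by rewrite subrr -scalar_mx_block.
have uU s : U s \in unitmx.
  by rewrite unitmxE det_ublock !det1 mulr1 unitr1.
rewrite -[L]mul1mx -UV -mulmxA; apply: affine_change_mul.
  by apply: affine_change_ublock => //; exact: oner_neq0.
apply: corner; first by rewrite unitmx_mul uU.
rewrite -(submxK L) mulmx_block block_mxKul mul1mx scale1r mxE a0 add0r.
by rewrite -rowE mxE; rewrite (ord1 j) in cij.
Qed.

End affine_space.

(** * Product integrands and the completed measure *)

Section product.
Variable R : realType.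
Notation leb := (@lebesgue_measure R).
Notation mu := (borel_lebesgue R).

Lemma measurable_prod_coord d (g : 'I_d -> measurableTypeR R -> R) :
  (forall i, measurable_fun setT (g i)) ->
  measurable_fun setT (fun x : borelV R d => \prod_i g i (x i 0)).
Proof.
move=> mg; apply: measurable_prod => i _.
exact: (measurableT_comp (mg i) (@measurable_coordV R d i)).
Qed.

Lemma integral_prod_coord d (g : 'I_d -> measurableTypeR R -> R) (c : 'I_d -> R) :
  (forall i, measurable_fun setT (g i)) -> (forall i t, 0 <= g i t) ->
  (forall i, \int[leb]_t (g i t)%:E = (c i)%:E)%E ->
  (\int[mu d]_x (\prod_i g i (x i ord0))%:E = (\prod_i c i)%:E)%E.
Proof.
elim: d g c => [|d IHd] g c mg g0 gc.
  under eq_integral do rewrite big_ord0.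
  by rewrite integral_cst//= big_ord0 mul1e diracT.
rewrite integral_borelV1; last 2 first.
- by apply/measurable_EFinP; exact: measurable_prod_coord.
- by move=> x; rewrite lee_fin prodr_ge0.
under eq_integral => t _.
  under eq_integral => y _.
    rewrite big_ord_recl /consV mxE unlift_none/=.
    under eq_bigr do rewrite mxE liftK/=.
    rewrite EFinM; over.
  rewrite ge0_integralZl_EFin//; last 2 first.
  - by move=> x _; rewrite lee_fin prodr_ge0.
  - by apply/measurable_EFinP; exact: (measurable_prod_coord (fun i => mg (lift ord0 i))).
  rewrite (IHd (fun i => g (lift ord0 i)) (fun i => c (lift ord0 i)))//.
  over.
rewrite ge0_integralZr//; last 3 first.
- exact/measurable_EFinP.
- by move=> x _; rewrite lee_fin.
- rewrite lee_fin prodr_ge0// => i _; rewrite -lee_fin -gc.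
  by apply: integral_ge0 => x _; rewrite lee_fin.
by rewrite gc -EFinM big_ord_recl.
Qed.

Lemma measurable_lebV d (X : set 'cV[R]_d) :
  measurable (X : set (borelV R d)) -> measurable (X : set (lebV R d)).
Proof. by move=> mX; apply: caratheodory_measurable_mu_ext. Qed.

Lemma measurable_fun_lebV d d' (T : measurableType d') (f : 'cV[R]_d -> T) :
  measurable_fun setT (f : borelV R d -> T) -> measurable_fun setT (f : lebV R d -> T).
Proof.
move=> mf _ Y mY; rewrite setTI; apply: measurable_lebV.
by rewrite -[X in measurable X]setTI; exact: mf.
Qed.

(** The identity is measurable from the completed structure to the Borel one and
    pushes the completed measure forward to the Borel measure. *)
Lemma integral_lebV d (f : 'cV[R]_d -> \bar R) :
  measurable_fun setT (f : borelV R d -> \bar R) -> (forall x, 0 <= f x)%E ->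
  (\int[lebesgueV R d]_x f x = \int[mu d]_x f x)%E.
Proof.
move=> mf f0.
have mid : measurable_fun setT (id : lebV R d -> borelV R d).
  by move=> _ Y mY; rewrite setTI; exact: measurable_lebV.
pose i : lebV R d -> borelV R d := id.
rewrite -[LHS]/(\int[lebesgueV R d]_(x in setT) ((f : borelV R d -> \bar R) \o i) x)%E.
rewrite -[X in (\int[_]_(x in X) _)%E](preimage_setT i).
rewrite -ge0_integral_pushforward//.
apply: eq_measure_integral => X mX _.
exact: measurable_mu_extE.
Qed.

End product.

(** * The Fejer kernel *)

Section fejer.
Variable R : realType.
Implicit Types (t : R) (m M l : nat).
Notation leb := (@lebesgue_measure R).

Definition dirichlet m t : R := 1 + 2 * \sum_(l < m) cos (l.+1%:R * (2 * pi * t)).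

Definition fejer M t : R := M.+1%:R^-1 * \sum_(m < M.+1) dirichlet m t.

Let C M (a : R) : R := \sum_(j < M) cos (j%:R * a).
Let S M (a : R) : R := \sum_(j < M) sin (j%:R * a).

(** With z = e(t) the right-hand side is |1 + z + ... + z^(M-1)|^2, which makes
    the Fejer kernel nonnegative. *)
Lemma sum_dirichlet M t :
  \sum_(m < M) dirichlet m t = C M (2 * pi * t) ^+ 2 + S M (2 * pi * t) ^+ 2.
Proof.
elim: M => [|M IHM]; first by rewrite /C /S !big_ord0 expr0n addr0.
rewrite big_ord_recr/= IHM /dirichlet /C /S !big_ord_recr/=.
set a := 2 * pi * t; rewrite -/(C M a) -/(S M a).
have -> : \sum_(l < M) cos (l.+1%:R * a) =
    cos (M%:R * a) * C M a + sin (M%:R * a) * S M a.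
  rewrite /C /S !mulr_sumr -big_split/= (reindex_inj rev_ord_inj)/=.
  by apply: eq_bigr => j _; rewrite -cosB -mulrBl -natrB ?subnSK// ltnW.
have := cos2Dsin2 (M%:R * a); move: (C M a) (S M a) (cos _) (sin _) => x y c s cs1.
lra.
Qed.

Lemma fejer_ge0 M t : 0 <= fejer M t.
Proof. by rewrite mulr_ge0// sum_dirichlet addr_ge0// sqr_ge0. Qed.

(** With z = e(t) and S = 1 + z + ... + z^M one has (1 - z) S = 1 - z^(M+1), of
    modulus at most 2, and |1 - z|^2 = 2 (1 - cos (2 pi t)). *)
Lemma fejer_cos M t : (1 - cos (2 * pi * t)) * fejer M t <= 2 / M.+1%:R.
Proof.
rewrite mulrCA mulrC ler_pM2r ?invr_gt0// sum_dirichlet.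
set a := 2 * pi * t.
have CE n : (1 - cos a) * C n a + sin a * S n a = 1 - cos (n%:R * a).
  elim: n => [|n IHn]; first by rewrite /C /S !big_ord0 mul0r cos0; ring.
  rewrite /C /S !big_ord_recr/= -/(C n a) -/(S n a).
  rewrite [n.+1%:R * a](_ : _ = n%:R * a + a) ?cosD; last by rewrite -natr1 mulrDl mul1r.
  move: IHn; lra.
have SE n : (1 - cos a) * S n a - sin a * C n a = - sin (n%:R * a).
  elim: n => [|n IHn]; first by rewrite /C /S !big_ord0 mul0r sin0; ring.
  rewrite /C /S !big_ord_recr/= -/(C n a) -/(S n a).
  rewrite [n.+1%:R * a](_ : _ = n%:R * a + a) ?sinD; last by rewrite -natr1 mulrDl mul1r.
  move: IHn; lra.
have := CE M.+1; have := SE M.+1; have := cos2Dsin2 a; have := cos2Dsin2 (M.+1%:R * a).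
have := cos_geN1 (M.+1%:R * a).
move: (C _ _) (S _ _) (cos (_ * _)) (sin (_ * _)) (cos a) (sin a) => x y c' s' c s.
move=> c'1 cs' cs E1 E2.
have E3 : (2 - 2 * c) * (x ^+ 2 + y ^+ 2) = 2 - 2 * c'.
  have -> : 2 - 2 * c = (1 - c) ^+ 2 + s ^+ 2 by lra.
  have -> : 2 - 2 * c' = (1 - c') ^+ 2 + (- s') ^+ 2 by lra.
  by rewrite -E1 -E2; ring.
have -> : (1 - c) * (x ^+ 2 + y ^+ 2) = (2 - 2 * c) * (x ^+ 2 + y ^+ 2) / 2 by field.
rewrite E3; lra.
Qed.

Lemma cos_periodZ t (k : int) : cos (2 * pi * (t + k%:~R)) = cos (2 * pi * t).
Proof.
have : e2pi (t + k%:~R) = e2pi t by rewrite e2piD e2pi_int mulr1.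
by case.
Qed.

Lemma dirichletE m t : dirichlet m t = 1 + 2 * \sum_(l < m) cos (2 * pi * (l.+1%:R * t)).
Proof. by congr (_ + _ * _); apply: eq_bigr => l _; congr cos; ring. Qed.

Lemma fejer_periodZ M t (k : int) : fejer M (t + k%:~R) = fejer M t.
Proof.
congr (_ * _); apply: eq_bigr => m _; rewrite !dirichletE; congr (_ + _ * _).
apply: eq_bigr => l _; 
have -> : l.+1%:R * (t + k%:~R) = l.+1%:R * t + (l.+1%:Z * k)%:~R.
  by rewrite mulrDr intrM.
exact: cos_periodZ.
Qed.

Lemma measurable_cosR : measurable_fun setT (@cos R : measurableTypeR R -> R).
Proof. by apply: continuous_measurable_fun; exact: continuous_cos. Qed.

Lemma measurable_sinR : measurable_fun setT (@sin R : measurableTypeR R -> R).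
Proof. by apply: continuous_measurable_fun; exact: continuous_sin. Qed.

Lemma measurable_cos_lin a : measurable_fun setT (fun t : measurableTypeR R => cos (a * t)).
Proof.
apply: (@measurableT_comp _ _ _ _ _ _ (@cos R) _ ( *%R a)); first exact: measurable_cosR.
exact: mulrl_measurable.
Qed.

Lemma measurable_fejer M : measurable_fun setT (fejer M : measurableTypeR R -> R).
Proof.
apply: measurable_funM => //; apply: measurable_sum => m.
apply: measurable_funD => //; apply: measurable_funM => //; apply: measurable_sum => l.
by under eq_fun do rewrite mulrA; exact: measurable_cos_lin.
Qed.

End fejer.

Section integral_sum.
Context d (T : measurableType d) (R : realType) (mu : {measure set T -> \bar R}).
Variables (D : set T) (mD : measurable D).

Lemma integrable_Rsum (I : Type) (s : seq I) (P : pred I) (f : I -> T -> R) :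
  (forall i, mu.-integrable D (EFin \o f i)) ->
  mu.-integrable D (EFin \o (fun x => \sum_(i <- s | P i) f i x)).
Proof.
move=> fi; have := integrable_sum mD s (P := P) (fun i _ => fi i).
by congr integrable; apply/funext => x /=; rewrite sumEFin.
Qed.

Lemma integrable_RZl (k : R) (f : T -> R) :
  mu.-integrable D (EFin \o f) -> mu.-integrable D (EFin \o (fun x => k * f x)).
Proof. exact: integrableZl. Qed.

Lemma Rintegral_sum (I : Type) (s : seq I) (P : pred I) (f : I -> T -> R) :
  (forall i, mu.-integrable D (EFin \o f i)) ->
  \int[mu]_(x in D) (\sum_(i <- s | P i) f i x) =
  \sum_(i <- s | P i) \int[mu]_(x in D) f i x.
Proof.
move=> fi; apply: EFin_inj; rewrite -sumEFin.
under [RHS]eq_bigr => i _.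
  rewrite /Rintegral fineK ?(integrable_fin_num mD (fi i))//.
  over.
rewrite -(integral_sum mD fi) /Rintegral fineK.
  by apply: eq_integral => x _; rewrite /= sumEFin.
exact: (integrable_fin_num mD (integrable_Rsum _ _ fi)).
Qed.

End integral_sum.

Section fejer_integral.
Variable R : realType.
Notation leb := (@lebesgue_measure R).

(** Half-open, so that its integer translates partition the line. *)
Definition cell : set (measurableTypeR R) := `[(- 2^-1)%R, 2^-1%R[%classic.

Lemma measurable_cell : measurable cell.
Proof. exact: measurable_itv. Qed.

Local Hint Resolve measurable_cell : core.

Lemma lebesgue_cell : leb cell = 1%E.
Proof.
rewrite lebesgue_measure_itv/= lte_fin -EFinB.
by rewrite ifT; [congr EFin; field|lra].
Qed.

Lemma integrable_cos_cell (a : R) : leb.-integrable cell (EFin \o (fun t => cos (a * t))).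
Proof.
apply: measurable_bounded_integrable; first exact: measurable_cell.
- by rewrite [ltLHS]lebesgue_cell ltry.
- exact: measurable_funTS (measurable_cos_lin a).
- by exists 1; split => // M M1 t _ /=; rewrite (le_trans (cos_max _))// ltW.
Qed.

Lemma integral_cos_cell l : \int[leb]_(t in cell) cos (2 * pi * (l.+1%:R * t)) = 0.
Proof.
pose a : R := 2 * pi * l.+1%:R.
have a0 : a != 0 by rewrite !mulf_neq0 ?pnatr_eq0// gt_eqF// pi_gt0.
pose F : R -> R := a^-1 *: (@sin R \o (a *: id)).
have dF (t : R) : is_derive t 1 F (cos (a * t)).
  apply: is_derive_eq; rewrite /GRing.scale/= mulr1; field.
  exact: a0.
have cF : continuous F.
  by move=> t; apply/differentiable_continuous/derivable1_diffP; exact: ex_derive.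
have sin_natpi (n : nat) : sin (n%:R * pi) = 0 :> R.
  by elim: n => [|n IHn]; rewrite ?mul0r ?sin0// -natr1 mulrDl mul1r sinDpi IHn oppr0.
have FTC := @continuous_FTC2 R (fun t => cos (a * t)) F (- 2^-1) 2^-1.
rewrite /Rintegral /cell.
under eq_integral do rewrite mulrA.
rewrite integral_itv_bndo_bndc; last first.
  apply/measurable_EFinP; exact: measurable_funTS (measurable_cos_lin a).
rewrite FTC.
- have FE t : F t = a^-1 * sin (a * t) by [].
  rewrite !FE mulrN sinN.
  have -> : a * 2^-1 = l.+1%:R * pi by rewrite /a; field.
  by rewrite sin_natpi oppr0 mulr0 subee.
- lra.
- apply: continuous_subspaceT => t; apply: continuous_comp.
    exact: mulrl_continuous.
  exact: continuous_cos.
- split.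
  + by move=> t _; exact: ex_derive.
  + exact/cvg_at_right_filter/cF.
  + exact/cvg_at_left_filter/cF.
- by move=> t _; rewrite derive1E; exact: derive_val.
Qed.

Lemma integral_fejer_cell M : (\int[leb]_(t in cell) (fejer M t)%:E = 1)%E.
Proof.
have ci l : leb.-integrable cell
    (EFin \o (fun t : measurableTypeR R => cos (2 * pi * (l.+1%:R * t)))).
  by under eq_fun do rewrite /= mulrA; exact: integrable_cos_cell.
have c1 : leb.-integrable cell (EFin \o (cst 1 : measurableTypeR R -> R)).
  by have := integrable_cos_cell 0; under eq_fun do rewrite /= mul0r cos0.
have csum m : leb.-integrable cell
    (EFin \o (fun t : measurableTypeR R => 2 * \sum_(l < m) cos (2 * pi * (l.+1%:R * t)))).
  by apply: integrable_RZl => //; exact: integrable_Rsum.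
have intD m : leb.-integrable cell (EFin \o (dirichlet m : measurableTypeR R -> R)).
  have := integrableD measurable_cell c1 (csum m).
  by congr integrable; apply/funext => t; rewrite /= dirichletE.
have intS M' : leb.-integrable cell
    (EFin \o (fun t : measurableTypeR R => \sum_(m < M') dirichlet m t)).
  exact: integrable_Rsum.
have : \int[leb]_(t in cell) fejer M t = 1.
  rewrite RintegralZl// Rintegral_sum//.
  rewrite (eq_bigr (fun=> 1)) => [|m _].
    by rewrite sumr_const card_ord mulVf.
  under eq_Rintegral do rewrite dirichletE.
  rewrite RintegralD// RintegralZl//; last exact: integrable_Rsum.
  rewrite Rintegral_sum// big1 ?mulr0 ?addr0 => [|l _]; last exact: integral_cos_cell.
  by rewrite Rintegral_cst// [X in fine X]lebesgue_cell mulr1.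
move=> I1; have iF : leb.-integrable cell (EFin \o (fejer M : measurableTypeR R -> R)).
  exact: integrable_RZl.
by rewrite -[LHS](fineK (integrable_fin_num measurable_cell iF)) -I1.
Qed.

End fejer_integral.

(** * Concentration of the Fejer kernel at the points of a lattice *)

Section weight.
Variables (R : realType) (d : nat) (A : 'M[R]_d).
Hypothesis uA : A \in unitmx.
Notation mu := (lebesgueV R d).
Implicit Types (x : 'cV[R]_d) (k : 'cV[int]_d) (m : 'I_d -> nat).

(** The coordinates for which the lattice A^-T Z^d becomes Z^d. *)
Definition dualcoord x i : R := (A^T *m x) i 0.

(** The Fejer kernel cut off to the parallelotope centred at A^-T k.  Its order may
    depend on the coordinate for the sake of [weight_cos]. *)
Definition weight m k x : R :=
  \prod_i (\1_(@cell R) (dualcoord x i - (k i 0)%:~R) * fejer (m i) (dualcoord x i)).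

Lemma dualcoord_node k i : dualcoord (node A k) i = (k i 0)%:~R.
Proof. by rewrite /dualcoord /node mulKVmx ?unitmx_tr// mxE. Qed.

Lemma measurable_dualcoord i :
  measurable_fun setT (fun x : borelV R d => dualcoord x i : measurableTypeR R).
Proof.
have := measurableT_comp (@measurable_coordV R d i) (measurable_affineV A^T 0).
by congr measurable_fun; apply/funext => x; rewrite /= addr0.
Qed.

Lemma weight_ge0 m k x : 0 <= weight m k x.
Proof. by apply: prodr_ge0 => i _; rewrite mulr_ge0 ?fejer_ge0. Qed.

Lemma weightE m k x : weight m k x =
  \prod_i (\1_(@cell R) ((A^T *m x - intV R k)%R i 0) * fejer (m i) ((A^T *m x - intV R k) i 0)).
Proof.
apply: eq_bigr => i _; rewrite !mxE /dualcoord mxE; congr (_ * _).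
by rewrite -mulrNz fejer_periodZ.
Qed.

Lemma measurable_bump M :
  measurable_fun setT (fun t : measurableTypeR R => \1_(@cell R) t * fejer M t).
Proof.
apply: measurable_funM; last exact: measurable_fejer.
by apply: measurable_indic; exact: measurable_cell.
Qed.

Lemma measurable_prod_bump m : measurable_fun setT
  (fun y : borelV R d => \prod_i (\1_(@cell R) (y i 0) * fejer (m i) (y i 0))).
Proof.
exact: (@measurable_prod_coord R d (fun i t => \1_(@cell R) t * fejer (m i) t)
  (fun i => measurable_bump (m i))).
Qed.

Lemma measurable_weight m k : measurable_fun setT (weight m k : borelV R d -> R).
Proof.
have := measurableT_comp (measurable_prod_bump m) (measurable_affineV A^T (- intV R k)).
by congr measurable_fun; apply/funext => x; rewrite weightE.
Qed.

(** By periodicity the weight is a function of A^T x - k.  The affine change of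
    variables leaves a product of integrals over [cell], all equal to 1. *)
Lemma integral_weight m k :
  (\int[mu]_x (weight m k x)%:E = (`|\det A|^-1)%:E)%E.
Proof.
rewrite integral_lebV; last 2 first.
- by apply/measurable_EFinP; exact: measurable_weight.
- by move=> x; rewrite lee_fin weight_ge0.
under eq_integral do rewrite weightE.
pose f (y : borelV R d) := (\prod_i (\1_(@cell R) (y i 0) * fejer (m i) (y i 0)))%:E.
have uAT : A^T \in unitmx by rewrite unitmx_tr.
have := affine_change_unit uAT (- intV R k) (f := f).
rewrite /f => ->; last 2 first.
- by apply/measurable_EFinP; exact: measurable_prod_bump.
- by move=> x; rewrite lee_fin prodr_ge0// => i _; rewrite mulr_ge0 ?fejer_ge0.
rewrite det_tr (@integral_prod_coord _ _ (fun i t => \1_(@cell R) t * fejer (m i) t) (fun=> 1)).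
- by rewrite big1// mule1.
- by move=> i; exact: measurable_bump.
- by move=> i t; rewrite mulr_ge0 ?fejer_ge0.
- move=> i; rewrite -[RHS](integral_fejer_cell R (m i)) [RHS]integral_mkcond.
  apply: eq_integral => t _; rewrite patchE indicE.
  by case: (_ \in _); rewrite ?mul1r ?mul0r.
Qed.

Lemma integrable_weight m k : mu.-integrable setT (EFin \o (weight m k : lebV R d -> R)).
Proof.
apply/integrableP; split.
  by apply/measurable_EFinP/measurable_fun_lebV; exact: measurable_weight.
under eq_integral => x _ do rewrite /= ger0_norm ?weight_ge0//.
by rewrite integral_weight ltry.
Qed.

Lemma Rintegral_weight m k : \int[mu]_x weight m k x = `|\det A|^-1.
Proof. by rewrite /Rintegral integral_weight. Qed.

Lemma integrable_weightM m k (h : lebV R d -> R) c :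
  measurable_fun setT h -> (forall x, `|h x| <= c) ->
  mu.-integrable setT (EFin \o (fun x => h x * weight m k x)).
Proof.
move=> mh hc; apply: (integrableMr measurableT mh _ (integrable_weight m k)).
exists c; split; first exact: num_real.
by move=> M cM x _; rewrite /= (le_trans (hc x))// ltW.
Qed.

Lemma fejer0 t : fejer 0 t = 1 :> R.
Proof. by rewrite /fejer big_ord1 /dirichlet big_ord0 mulr0 addr0 mulr1 invr1. Qed.

(** Since the kernel of order 0 is the constant 1, the right-hand side is again a
    multiple of a weight, and its integral is known. *)
Lemma weight_cos M k x i :
  (1 - cos (2 * pi * dualcoord x i)) * weight (fun=> M) k x <=
  2 / M.+1%:R * weight (fun j => if j == i then 0%N else M) k x.
Proof.
rewrite /weight (bigD1 i)//= [in leRHS](bigD1 i)//= eqxx fejer0 mulr1.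
rewrite (eq_bigr (fun j => \1_(@cell R) (dualcoord x j - (k j 0)%:~R) *
    fejer (if j == i then 0%N else M) (dualcoord x j))); last first.
  by move=> j /negbTE ->.
have := fejer_cos M (dualcoord x i); set c := 1 - _.
move: (fejer M _) => F; set I0 := \1_(@cell R) _; set P := \prod_(_ < _ | _) _ => cF.
rewrite (_ : c * (I0 * F * P) = c * F * (I0 * P)); last by ring.
apply: ler_wpM2r cF; rewrite mulr_ge0//.
by apply: prodr_ge0 => j _; rewrite mulr_ge0 ?fejer_ge0.
Qed.

Lemma measurable_dualcos i :
  measurable_fun setT (fun x : lebV R d => 1 - cos (2 * pi * dualcoord x i)).
Proof.
have mc := measurableT_comp (measurable_cos_lin (2 * pi)) (measurable_dualcoord i).
have mc' := measurable_fun_lebV mc.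
apply: measurable_funB; first exact: measurable_cst.
exact: mc'.
Qed.

(** Korovkin's argument: up to e the deviation of v from v0 is dominated by the
    test functions 1 - cos (2 pi (A^T x)_i), whose integrals against the weight are
    at most 2 |det A|^-1 / (M + 1) by [weight_cos]. *)
Lemma cvg_weight k (v : lebV R d -> R) (v0 : R) c :
  measurable_fun setT v -> (forall x, `|v x| <= c) ->
  (forall e, 0 < e -> exists2 a, 0 <= a & forall x,
    (forall i, cell (dualcoord x i - (k i 0)%:~R)) ->
    `|v x - v0| <= e + a * \sum_i (1 - cos (2 * pi * dualcoord x i))) ->
  (fun M => \int[mu]_x (v x * weight (fun=> M) k x)) @ \oo --> `|\det A|^-1 * v0.
Proof.
move=> mv vc vloc; set D := `|\det A|^-1.
have D0 : 0 < D by rewrite invr_gt0 normr_gt0 -unitfE -unitmxE.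
have mvv : measurable_fun setT (fun x : lebV R d => v x - v0) by exact: measurable_funB.
have bvv x : `|v x - v0| <= c + `|v0| by rewrite (le_trans (ler_normB _ _))// lerD2r.
have mcos := measurable_dualcos.
have bcos x i : `|1 - cos (2 * pi * dualcoord x i)| <= 2.
  by rewrite ger0_norm; have := cos_geN1 (2 * pi * dualcoord x i);
    have := cos_le1 (2 * pi * dualcoord x i); lra.
have main e : 0 < e -> exists2 a, 0 <= a & forall M,
    `|D * v0 - \int[mu]_x (v x * weight (fun=> M) k x)| <=
    D * (e + a * d%:R * 2 / M.+1%:R).
  move=> /vloc[a a0 va]; exists a => // M.
  have iv := integrable_weightM (fun=> M) k mv vc.
  have iW := integrable_weight (fun=> M) k.
  have ivv := integrable_weightM (fun=> M) k mvv bvv.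
  have ic i := integrable_weightM (fun=> M) k (mcos i) (bcos ^~ i).
  have -> : D * v0 = \int[mu]_x (v0 * weight (fun=> M) k x).
    by rewrite RintegralZl// Rintegral_weight mulrC.
  rewrite distrC -RintegralB//; last exact: integrable_RZl.
  rewrite (le_trans (le_normr_Rintegral _ _))//.
    by under eq_fun do rewrite -mulrBl.
  have isum : mu.-integrable setT (EFin \o (fun x : lebV R d =>
      \sum_i (1 - cos (2 * pi * dualcoord x i)) * weight (fun=> M) k x)).
    exact: integrable_Rsum.
  pose g (x : lebV R d) := e * weight (fun=> M) k x +
      a * \sum_i (1 - cos (2 * pi * dualcoord x i)) * weight (fun=> M) k x.
  have ig : mu.-integrable setT (EFin \o g).
    have := integrableD measurableT (integrable_RZl measurableT e iW)
      (integrable_RZl measurableT a isum).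
    by congr integrable; apply/funext.
  apply: (@le_trans _ _ (\int[mu]_x g x)).
    apply: le_Rintegral => //.
      have := integrable_norm ivv.
      by congr integrable; apply/funext => x /=; rewrite -mulrBl.
    move=> x _; rewrite -mulrBl normrM (ger0_norm (weight_ge0 _ _ _)) /g.
    rewrite -mulr_suml mulrA -mulrDl.
    have [|out] := pselect (forall i, cell (dualcoord x i - (k i 0)%:~R)).
      by move=> /va vax; rewrite ler_wpM2r ?weight_ge0.
    suff -> : weight (fun=> M) k x = 0 by rewrite !mulr0.
    have [i /negP iout] : exists i, dualcoord x i - (k i 0)%:~R \notin @cell R.
      apply: contrapT => nex; apply: out => i; apply: contrapT => iout.
      by apply: nex; exists i; rewrite notin_setE.
    by rewrite /weight (bigD1 i)//= indicE memNset ?mul0r// => /mem_set.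
  rewrite RintegralD//; [|exact: integrable_RZl|exact: integrable_RZl].
  rewrite !RintegralZl// Rintegral_weight Rintegral_sum//.
  rewrite -/D (_ : D * _ = e * D + a * (D * (d%:R * (2 / M.+1%:R)))); last by ring.
  rewrite lerD2l ler_wpM2l//.
  have -> : D * (d%:R * (2 / M.+1%:R)) = \sum_(i < d) 2 / M.+1%:R * D.
    by rewrite sumr_const card_ord -mulr_natr; ring.
  apply: ler_sum => i _; rewrite /D -(Rintegral_weight (fun j => if j == i then 0%N else M) k).
  rewrite -RintegralZl//; last exact: integrable_weight.
  apply: le_Rintegral => //; first exact/integrable_RZl/integrable_weight.
  by move=> x _; exact: weight_cos.
apply/cvgrPdist_le => e e0; have ltr0n2 : 0 < 2 :> R by [].
have [a a0 bnd] := main (e / (2 * D)) (divr_gt0 e0 (mulr_gt0 ltr0n2 D0)).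
(* the second half of e must exceed D a d 2 / (M + 1); the 1 keeps q positive *)
pose q := D * a * d%:R * 4 + 1.
have q0 : 0 < q by rewrite ltr_wpDl// !mulr_ge0// ltW.
have := near_infty_natSinv_lt (PosNum (divr_gt0 e0 q0)); apply: filterS => M /= Mq.
apply: (le_trans (bnd M)).
have {Mq} : D * a * d%:R * 4 * M.+1%:R^-1 <= e.
  rewrite (le_trans (_ : _ <= q * M.+1%:R^-1))//.
    by rewrite ler_wpM2r// lerDl.
  by rewrite mulrC -ler_pdivlMr// ltW.
have -> : D * (e / (2 * D) + a * d%:R * 2 / M.+1%:R) =
    e / 2 + D * a * d%:R * 4 * M.+1%:R^-1 / 2 by field; rewrite ?gt_eqF.
move: (_ / M.+1%:R) => X; lra.
Qed.

End weight.

Section local_control.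
Variables (R : realType) (d : nat) (A : 'M[R]_d).
Hypothesis uA : A \in unitmx.
Implicit Types (x : 'cV[R]_d) (k : 'cV[int]_d).

Lemma sum_1Bcos_ge0 x : 0 <= \sum_i (1 - cos (2 * pi * dualcoord A x i)).
Proof. by apply: sumr_ge0 => i _; rewrite subr_ge0 cos_le1. Qed.

(** The entries of A^T x - k control the distance from x to A^-T k.  The bound 1/2
    on q keeps 2 pi q in the range where the cosine decreases. *)
Lemma near_node k (P : 'cV[R]_d -> Prop) : (\forall x \near node A k, P x) ->
  exists2 q : R, 0 < q <= 2^-1 &
    forall x, (forall i, `|dualcoord A x i - (k i 0)%:~R| < q) -> P x.
Proof.
move=> /nbhs_ballP[e /= e0 eP].
pose L := invmx A^T; pose c := \sum_i \sum_j `|L i j|.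
have c0 : 0 <= c by apply: sumr_ge0 => i _; apply: sumr_ge0.
have c1 : 0 < c + 1 by rewrite ltr_wpDl.
exists (Num.min (e / (c + 1)) 2^-1).
  by rewrite lt_min divr_gt0//= invr_gt0 ltr0n/= ge_min lexx orbT.
move=> x xq; apply: eP; split => // i j; rewrite (ord1 j) /ball/= -normrN opprB.
have -> : x i 0 - node A k i 0 = \sum_l L i l * (dualcoord A x l - (k l 0)%:~R).
  rewrite -[x in LHS](mulKmx (_ : A^T \in unitmx)) ?unitmx_tr// -/L.
  rewrite /node -/L !mxE -sumrB; apply: eq_bigr => l _.
  by rewrite -mulrBr /dualcoord !mxE.
apply: (@le_lt_trans _ _ (c * (e / (c + 1)))); last first.
  by rewrite mulrA ltr_pdivrMr// mulrC ltr_pM2l// ltrDl.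
rewrite (le_trans (ler_norm_sum _ _ _))//.
apply: (@le_trans _ _ (\sum_l `|L i l| * (e / (c + 1)))).
  apply: ler_sum => l _; rewrite normrM ler_wpM2l//.
  by have := xq l; rewrite lt_min => /andP[/ltW].
rewrite -mulr_suml; apply: ler_wpM2r; first by rewrite divr_ge0 ?ltW.
rewrite /c [leRHS](bigD1 i)//= lerDl; apply: sumr_ge0 => l _; exact: sumr_ge0.
Qed.

Lemma cell_cos (q t : R) : 0 < q <= 2^-1 -> cell t -> q <= `|t| ->
  1 - cos (2 * pi * q) <= 1 - cos (2 * pi * t).
Proof.
move=> /andP[q0 q1]; rewrite /cell/= in_itv/= => /andP[t0 t1] qt.
have pi0 := pi_gt0 R.
rewrite lerD2l lerN2 -(cos_norm (2 * pi * t)) normrM (gtr0_norm (_ : 0 < 2 * pi)) ?mulr_gt0//.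
have at1 : `|t| <= 2^-1 by rewrite ler_norml t0 ltW.
have rng (s : R) : 0 <= s -> s <= 2^-1 -> 2 * pi * s \in `[0, pi].
  move=> s0 s1; rewrite in_itv/=; apply/andP; split; first by rewrite mulr_ge0//; lra.
  have : pi * (2 * s) <= pi * 1 by rewrite ler_pM2l//; lra.
  lra.
have qi := rng q (ltW q0) q1; have ti := rng `|t| (normr_ge0 t) at1.
by rewrite leNgt (ltr_cos ti qi) -leNgt ler_pM2l// mulr_gt0.
Qed.

Lemma cos_lt1 (q : R) : 0 < q <= 2^-1 -> 0 < 1 - cos (2 * pi * q).
Proof.
move=> /andP[q0 q1]; have pi0 := pi_gt0 R.
have z : 0 \in `[0, pi : R] by rewrite in_itv/= lexx ltW.
have qpi : 2 * pi * q \in `[0, pi].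
  rewrite in_itv/=; apply/andP; split; first by rewrite mulr_ge0//; lra.
  have : pi * (2 * q) <= pi * 1 by rewrite ler_pM2l//; lra.
  lra.
by rewrite subr_gt0 -[ltRHS]cos0 (ltr_cos z qpi) mulr_gt0//; lra.
Qed.

(** Near the node the deviation is at most e.  In the rest of the parallelotope
    some entry of A^T x - k is at least q in absolute value, and then one term of
    the sum is at least 1 - cos (2 pi q), while the deviation is at most 2. *)
Lemma korovkin_control k (v : 'cV[R]_d -> R) :
  (forall x, `|v x| <= 1) ->
  (forall e, 0 < e -> \forall x \near node A k, `|v x - v (node A k)| <= e) ->
  forall e, 0 < e -> exists2 a, 0 <= a & forall x,
    (forall i, cell (dualcoord A x i - (k i 0)%:~R)) ->
    `|v x - v (node A k)| <= e + a * \sum_i (1 - cos (2 * pi * dualcoord A x i)).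
Proof.
move=> v1 vc e e0; have [q q01 qP] := near_node (vc e e0).
have cq := cos_lt1 q01.
have a0 : 0 <= 2 / (1 - cos (2 * pi * q)) by rewrite divr_ge0// ltW.
exists (2 / (1 - cos (2 * pi * q))) => // x xc.
have [xq|] := pselect (forall i, `|dualcoord A x i - (k i 0)%:~R| < q).
  by rewrite (le_trans (qP _ xq))// lerDl mulr_ge0// sum_1Bcos_ge0.
move=> /existsNP[i /negP]; rewrite -leNgt => qi.
rewrite (@le_trans _ _ 2)//.
  by rewrite (le_trans (ler_normB _ _))// -[leRHS]/(1 + 1) lerD.
have := cell_cos q01 (xc i) qi.
have -> : cos (2 * pi * (dualcoord A x i - (k i 0)%:~R)) = cos (2 * pi * dualcoord A x i).
  by rewrite -mulrNz cos_periodZ.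
move=> ci; rewrite ler_wpDl ?(ltW e0)//.
rewrite mulrAC ler_pdivlMr// ler_wpM2l//.
rewrite (le_trans ci)// [leRHS](bigD1 i)//= lerDl.
by apply: sumr_ge0 => j _; rewrite subr_ge0 cos_le1.
Qed.

Lemma indic_near_cst (Omega : set 'cV[R]_d) k :
  ~ boundary Omega (node A k) ->
  \forall x \near node A k, (\1_Omega x : R) = \1_Omega (node A k).
Proof.
move=> /not_andP[|].
  rewrite /closure => /existsNP[U]/not_implyP[nU] UO.
  have UE x : U x -> ~ Omega x by move=> Ux Ox; apply: UO; exists x.
  apply: filterS (nU) => x Ux.
  by rewrite !indicE !memNset//; apply: UE => //; exact: nbhs_singleton.
move=> /contrapT intO; apply: filterS (intO) => x Ox.
by rewrite !indicE !mem_set//; exact: nbhs_singleton.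
Qed.

Lemma continuous_dot (y : 'cV[R]_d) : continuous (dot y : 'cV[R]_d -> R).
Proof.
have -> : dot y = fun x => \sum_i y i 0 * x i 0.
  by apply/funext => x; rewrite /dot !mxE; apply: eq_bigr => i _; rewrite mxE.
apply: (@continuous_big R _ +%R) => [|i _]; first exact: add_continuous.
move=> x; apply: (@continuous_comp _ _ _ (fun x : 'cV[R]_d => x i 0) ( *%R (y i 0))).
  exact: coord_continuous.
exact: mulrl_continuous.
Qed.

End local_control.

(** * Fejer means over a bounded set *)

Section enumeration.
Variable d : nat.

(** The values are the integer points of the cube |k_i| <= r.  Indexing them by
    finite functions lets sums of products over them be factored. *)
Definition shiftV r (s : {ffun 'I_d -> 'I_(r.*2.+1)}) : 'cV[int]_d :=
  \col_i ((s i : nat)%:Z - r%:Z).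

Lemma shiftV_inj r : injective (@shiftV r).
Proof.
move=> s s' /colP ss'; apply/ffunP => i; apply: val_inj => /=.
by have := ss' i; rewrite !mxE => /addIr [].
Qed.

Lemma shiftV_surj r (k : 'cV[int]_d) : (forall i, `|k i 0%R| <= r)%N ->
  exists s : {ffun 'I_d -> 'I_(r.*2.+1)}, shiftV s = k.
Proof.
move=> kr.
have kj i : (`|(k i 0 + r%:Z)%R| < r.*2.+1)%N.
  by have := kr i; move: (k i 0) => z; lia.
exists [ffun i => Ordinal (kj i) : 'I_(r.*2.+1)]; apply/colP => i.
by rewrite mxE ffunE /=; have := kr i; move: (k i 0) => z; lia.
Qed.

Lemma fsbig_shiftV (V : nmodType) r (Q : set 'cV[int]_d) (F : 'cV[int]_d -> V) :
  (forall k i, Q k -> (`|k i 0%R| <= r)%N) ->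
  \sum_(k \in Q) F k = \sum_(s | `[< Q (@shiftV r s) >]) F (shiftV s).
Proof.
move=> Qr; pose P := [set s | Q (@shiftV r s)].
rewrite (reindex_fsbig (@shiftV r) P Q); last first.
  split => //; first by move=> s s' _ _; exact: shiftV_inj.
  move=> k Qk; have [|s sk] := @shiftV_surj r k; first by move=> i; exact: Qr.
  by exists s; rewrite /P/= ?sk.
rewrite fsbig_mkcond [RHS]big_mkcond /=.
have -> : [set: {ffun 'I_d -> 'I_(r.*2.+1)}] = [set` index_enum _].
  by apply/seteqP; split => s // _; rewrite /= mem_index_enum.
rewrite -fsbig_seq; last exact: index_enum_uniq.
apply: eq_bigr => s _; rewrite /patch.
by case: asboolP => Qs; [rewrite mem_set|rewrite memNset].
Qed.

End enumeration.

Section cells.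
Variables (R : realType) (d : nat) (A : 'M[R]_d).
Implicit Types (x : 'cV[R]_d) (k : 'cV[int]_d).

Lemma cell_floor (t : R) (n : int) :
  (t - n%:~R \in @cell R) = (Num.floor (t + 2^-1) == n).
Proof.
rewrite floor_eq /cell mem_setE in_itv/= intrD; congr (_ && _).
  by apply/idP/idP; lra.
by apply/idP/idP; lra.
Qed.

Lemma sum_cell (r : nat) (t : R) : `|t| + 1 <= r%:R ->
  \sum_(j < r.*2.+1) \1_(@cell R) (t - ((j : nat)%:Z - r%:Z)%:~R) = 1 :> R.
Proof.
(* rounding t to the nearest integer gives the only translate that contains t *)
move=> tr; pose n := Num.floor (t + 2^-1).
have n_r : (`|n| <= r)%N.
  have := ge_floor (t + 2^-1); have := floorD1_gt (t + 2^-1); rewrite -/n intrD.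
  move: tr; rewrite -lerBrDr ler_norml => /andP[t1 t2] n1 n2.
  rewrite -lez_nat abszE -(ler_int R) intr_norm ler_norml.
  apply/andP; split; rewrite -?pmulrn; lra.
have nr : (`|(n + r%:Z)%R| < r.*2.+1)%N by move: n n_r => n; lia.
rewrite (bigD1 (Ordinal nr))//= big1 => [|j jn]; rewrite indicE cell_floor.
  rewrite addr0 -/n; case: eqP => //; case; lia.
case: eqP => // nE; case/eqP: jn; apply: val_inj => /=; rewrite -/n in nE; lia.
Qed.

(** Exactly one of the enumerated parallelotopes contains the point. *)
Lemma sum_weight r M x : (forall i, `|dualcoord A x i| + 1 <= r%:R) ->
  \sum_s weight A (fun=> M) (@shiftV d r s) x = \prod_i fejer M (dualcoord A x i).
Proof.
move=> xr; pose G i (j : 'I_(r.*2.+1)) : R :=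
  \1_(@cell R) (dualcoord A x i - ((j : nat)%:Z - r%:Z)%:~R) * fejer M (dualcoord A x i).
transitivity (\prod_i \sum_j G i j).
  rewrite bigA_distr_bigA; apply: eq_bigr => s _; apply: eq_bigr => i _.
  by rewrite /G mxE.
by apply: eq_bigr => i _; rewrite -mulr_suml sum_cell// mul1r.
Qed.

Lemma bounded_dualcoord (Omega : set 'cV[R]_d) : bounded_set Omega ->
  exists r : nat, forall x i, Omega x -> `|dualcoord A x i| + 1 <= r%:R.
Proof.
move=> [c [_ /(_ (c + 1) (ltr_pwDr ltr01 (lexx c)))Oc]].
pose q := \sum_i \sum_j `|A^T i j| * (c + 2).
exists (Num.bound (q + 1)) => x i Ox.
have xc : `|x| < c + 2 by rewrite (le_lt_trans (Oc x Ox))// ltrD2l ltr1n.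
have c0 : 0 <= c + 2 by rewrite (le_trans (normr_ge0 x))// ltW.
have xj j : `|x j 0| <= c + 2.
  have : ball 0 (c + 2) x by rewrite mx_norm_ball /ball_/= sub0r normrN.
  by move=> [_ /(_ j 0)]; rewrite /ball/= mxE sub0r normrN => /ltW.
have qi : `|dualcoord A x i| <= q.
  rewrite /dualcoord mxE (le_trans (ler_norm_sum _ _ _))//.
  rewrite /q [leRHS](bigD1 i)//= (@le_trans _ _ (\sum_j `|A^T i j| * (c + 2)))//.
    by apply: ler_sum => j _; rewrite normrM ler_wpM2l.
  by rewrite lerDl; apply: sumr_ge0 => l _; apply: sumr_ge0 => j _; rewrite mulr_ge0.
have q0 : 0 <= q + 1 by rewrite addr_ge0// (le_trans (normr_ge0 _) qi).
by have := archi_boundP q0; move: qi; lra.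
Qed.

End cells.

Section fejer_means.
Variables (R : realType) (d : nat) (A : 'M[R]_d).
Hypothesis uA : A \in unitmx.
Notation mu := (lebesgueV R d).
Implicit Types (x : 'cV[R]_d) (k : 'cV[int]_d).
Variables (Omega : set 'cV[R]_d) (r : nat).
Hypothesis mO : measurable (Omega : set (lebV R d)).
Hypothesis Or : forall x i, Omega x -> `|dualcoord A x i| + 1 <= r%:R.
Hypothesis bO : forall k, ~ boundary Omega (node A k).

Lemma Lambda_bound k i : Lambda A Omega k -> (`|k i 0%R| <= r)%N.
Proof.
move=> /Or => /(_ i); rewrite dualcoord_node// => kr.
rewrite -lez_nat abszE -(ler_int R) intr_norm -pmulrn; lra.
Qed.

Variable u : 'cV[R]_d -> R.
Hypothesis mu' : measurable_fun setT (u : lebV R d -> R).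
Hypothesis u1 : forall x, `|u x| <= 1.
Hypothesis cu : continuous u.

Let v (x : lebV R d) : R := \1_Omega x * u x.

(** The mean splits into the integrals of v against the weights of finitely many
    lattice points; v is continuous at each of them because the indicator function
    of Omega is constant near a point off the boundary. *)
Lemma cvg_fejer_mean :
  (fun M => \int[mu]_(x in Omega) (u x * \prod_i fejer M (dualcoord A x i)))
    @ \oo --> `|\det A|^-1 * \sum_(k \in Lambda A Omega) u (node A k).
Proof.
have mv : measurable_fun setT v by apply: measurable_funM => //; exact: measurable_indic.
have v1 x : `|v x| <= 1.
  by rewrite /v indicE; case: (_ \in _); rewrite ?mul1r ?mul0r ?normr0.
rewrite (fsbig_shiftV _ Lambda_bound) mulr_sumr.
have intE M : \int[mu]_(x in Omega) (u x * \prod_i fejer M (dualcoord A x i)) =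
    \sum_s \int[mu]_x (v x * weight A (fun=> M) (@shiftV d r s) x).
  rewrite Rintegral_mkcond -Rintegral_sum//; last first.
    by move=> s; apply: integrable_weightM mv v1.
  apply: eq_Rintegral => x _; rewrite patchE -mulr_sumr /v indicE.
  case: ifPn => [xO|_]; last by rewrite !mul0r.
  by rewrite mul1r sum_weight// => i; apply: Or; rewrite inE in xO.
under eq_fun do rewrite intE.
have -> : \sum_(s | `[< Lambda A Omega (@shiftV d r s) >])
      `|\det A|^-1 * u (node A (shiftV s)) =
    \sum_s `|\det A|^-1 * v (node A (@shiftV d r s)).
  rewrite big_mkcond/=; apply: eq_bigr => s _; rewrite /v indicE /Lambda/=.
  case: asboolP => O; first by rewrite mem_set// mul1r.
  by rewrite memNset// mul0r mulr0.
apply: cvg_big => [|s _]; first exact: add_continuous.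
apply: (cvg_weight uA mv v1).
apply: (korovkin_control uA v1) => e e0.
have /cvgrPdist_le/(_ e e0) : {for node A (@shiftV d r s), continuous u} by exact: cu.
move=> cue.
apply: filterS (filterI (indic_near_cst (@bO (@shiftV d r s))) cue) => x [Ix ux].
rewrite /v Ix -mulrBr normrM distrC indicE.
by case: (_ \in _); rewrite ?normr1 ?mul1r// normr0 mul0r ltW.
Qed.

End fejer_means.

(** * Limits of complex sequences *)

Section complex_limits.
Variable R : realType.
Local Open Scope complex_scope.

Lemma sum_complex (I : Type) (s : seq I) (P : pred I) (a b : I -> R) :
  \sum_(i <- s | P i) (a i +i* b i) =
  (\sum_(i <- s | P i) a i) +i* (\sum_(i <- s | P i) b i) :> R[i].
Proof.
elim: s => [|i s IHs]; first by rewrite !big_nil.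
by rewrite !big_cons IHs; case: (P i).
Qed.

Lemma cvg_complex (a b : nat -> R) (la lb : R) :
  a @ \oo --> la -> b @ \oo --> lb ->
  (fun M => (a M +i* b M) : R[i]^o) @ \oo --> ((la +i* lb) : R[i]^o).
Proof.
move=> /cvgrPdist_le ca /cvgrPdist_le cb; apply/cvgrPdist_le => -[e e'].
rewrite ltcE/= => /andP[/eqP e'0 e0].
have e20 : 0 < e / 2 by rewrite divr_gt0.
apply: filterS (filterI (ca _ e20) (cb _ e20)) => M [aM bM].
have -> : (la +i* lb - (a M +i* b M) : R[i]) = (la - a M)%:C + 'i * (lb - b M)%:C.
  by apply/eqP; rewrite eq_complex /=; apply/andP; split; apply/eqP; ring.
rewrite (le_trans (ler_normD _ _))// normrM normCi mul1r !normc_def/=.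
rewrite !expr0n/= !addr0 !sqrtr_sqr -!rmorphD/= lecE/= e'0 eqxx/=; lra.
Qed.

End complex_limits.

Section kernel.
Variable R : realType.
Local Open Scope complex_scope.

Lemma e2pi_sym (t : R) : e2pi t + e2pi (- t) = (2 * cos (2 * pi * t))%:C.
Proof.
apply/eqP; rewrite eq_complex /= mulrN cosN sinN subrr eqxx andbT.
by apply/eqP; ring.
Qed.

Lemma e2pi_bigsum (I : Type) (s : seq I) (P : pred I) (t : I -> R) :
  e2pi (\sum_(i <- s | P i) t i) = \prod_(i <- s | P i) e2pi (t i).
Proof. by apply: (big_morph (@e2pi R)); [exact: e2piD|exact: e2pi0]. Qed.

(** The range is the one of [shiftV], so the frequency j - M runs over [-m, m]. *)
Lemma sum_e2pi_dirichlet M m (t : R) : (m <= M)%N ->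
  \sum_(j < M.*2.+1 | (`|((j : nat)%:Z - M%:Z)%R| <= m)%N)
    e2pi (((j : nat)%:Z - M%:Z)%:~R * t) = (dirichlet m t)%:C.
Proof.
elim: m => [|m IHm] mM.
  have MM : (M < M.*2.+1)%N by lia.
  rewrite (big_pred1 (Ordinal MM)) => [|j].
    by rewrite /= subrr mul0r e2pi0 /dirichlet big_ord0 mulr0 addr0.
  by rewrite /= -val_eqE /=; lia.
have Mp : (M + m.+1 < M.*2.+1)%N by lia.
have Mm : (M - m.+1 < M.*2.+1)%N by lia.
rewrite (bigD1 (Ordinal Mp))/=; last by lia.
rewrite (bigD1 (Ordinal Mm))/=; last by rewrite -val_eqE/=; lia.
rewrite addrA (eq_bigl (fun j : 'I_(M.*2.+1) => (`|((j : nat)%:Z - M%:Z)%R| <= m)%N)); last first.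
  by move=> j; rewrite -(inj_eq val_inj j (Ordinal Mp)) -(inj_eq val_inj j (Ordinal Mm))/=; lia.
rewrite IHm ?(ltnW mM)//.
have -> : ((M + m.+1)%N%:Z - M%:Z)%:~R = m.+1%:R :> R.
  by rewrite (_ : _ - _ = m.+1%:Z); last lia.
have -> : ((M - m.+1)%N%:Z - M%:Z)%:~R = - m.+1%:R :> R.
  by rewrite (_ : _ - _ = - m.+1%:Z); [rewrite mulrNz|lia].
rewrite mulNr e2pi_sym /dirichlet big_ord_recr/= -rmorphD/=; congr (_%:C).
by rewrite (mulrCA _ (2 * pi)); ring.
Qed.

Lemma finite_box d M (m : {ffun 'I_d -> 'I_M}) : finite_set (box m).
Proof.
apply: (sub_finite_set (B := range (@shiftV d M))); last exact: finite_image.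
move=> k km; have [|s <-] := @shiftV_surj d M k; last by exists s.
by move=> i; rewrite (leq_trans (km i))// ltnW.
Qed.

Lemma sum_box_e2pi d M (m : {ffun 'I_d -> 'I_M.+1}) (t : 'I_d -> R) :
  \sum_(k \in box m) e2pi (\sum_i (k i 0)%:~R * t i) =
  (\prod_i dirichlet (m i) (t i))%:C.
Proof.
rewrite (@fsbig_shiftV _ _ M); last first.
  by move=> k i km; exact: leq_trans (km i) (leq_ord (m i)).
rewrite rmorph_prod/=.
have dE i : (dirichlet (m i) (t i))%:C = _ :=
  esym (@sum_e2pi_dirichlet M (m i) (t i) (leq_ord (m i))).
under [RHS]eq_bigr do rewrite dE.
rewrite bigA_distr_big_dep/=; apply: eq_big => [s|s _].
  by apply/asboolP/familyP => sm i; have := sm i; rewrite /= mxE.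
by rewrite e2pi_bigsum; apply: eq_bigr => i _; rewrite mxE.
Qed.

End kernel.

(** * Summation of the lattice translates of Psi *)

Section cesaro.
Variables (R : realType) (d : nat) (A B : 'M[R]_d) (N : 'M[int]_d).
Variables (Omega : set 'cV[R]_d) (r : nat).
Hypothesis uA : A \in unitmx.
Hypothesis NE : map_mx intr N = B^T *m A.
Hypothesis mO : measurable (Omega : set (lebV R d)).
Hypothesis Or : forall x i, Omega x -> `|dualcoord A x i| + 1 <= r%:R.
Hypothesis bO : forall k, ~ boundary Omega (node A k).
Notation mu := (lebesgueV R d).
Implicit Types (x y z : 'cV[R]_d).
Local Open Scope complex_scope.

(** The weights of order 0 are indicators of parallelotopes of finite measure, and
    finitely many of these cover Omega. *)
Lemma integrable_bounded (h : lebV R d -> R) : measurable_fun setT h ->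
  (forall z, `|h z| <= 1) -> mu.-integrable Omega (EFin \o h).
Proof.
move=> mh h1; apply/(integrable_mkcond _ mO).
pose v (z : lebV R d) : R := \1_Omega z * h z.
have mv : measurable_fun setT v by apply: measurable_funM => //; exact: measurable_indic.
have v1 z : `|v z| <= 1.
  by rewrite /v indicE; case: (_ \in _); rewrite ?mul1r ?mul0r ?normr0.
have := integrable_Rsum measurableT (index_enum {ffun 'I_d -> 'I_(r.*2.+1)}) xpredT
  (fun s => integrable_weightM uA (fun=> 0%N) (shiftV s) mv v1).
congr integrable; apply/funext => z; rewrite /= -mulr_sumr patchE /v indicE.
case: ifPn => [zO|_]; last by rewrite !mul0r.
rewrite mul1r sum_weight; last by move=> i; apply: Or; rewrite inE in zO.
by rewrite big1 ?mulr1// => i _; rewrite fejer0.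
Qed.

Lemma measurable_dot y :
  measurable_fun setT (fun z : borelV R d => 2 * pi * dot y z : measurableTypeR R).
Proof.
have -> : (fun z : borelV R d => 2 * pi * dot y z) = fun z => 2 * pi * \sum_i y i 0 * z i 0.
  by apply/funext => z; rewrite /dot mxE; congr (_ * _); apply: eq_bigr => i _; rewrite mxE.
apply: measurable_funM => //; apply: measurable_sum => i; apply: measurable_funM => //.
exact: measurable_coordV.
Qed.

Lemma dot_translate x (k : 'cV[int]_d) z :
  dot (x + A *m intV R k) z = dot x z + \sum_i (k i 0)%:~R * dualcoord A z i.
Proof.
rewrite /dot raddfD/= mulmxDl mxE; congr (_ + _).
by rewrite trmx_mul -mulmxA mxE; apply: eq_bigr => i _; rewrite /dualcoord !mxE.
Qed.

(** The sum over a box factors into Dirichlet kernels, and averaging each of the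
    orders m_i over 0, ..., M turns these into Fejer kernels. *)
Lemma cesaro_kernel M x z :
  \sum_(m : {ffun 'I_d -> 'I_M.+1}) \sum_(k \in box m) e2pi (dot (x + A *m intV R k) z) =
  e2pi (dot x z) * (M.+1%:R ^+ d * \prod_i fejer M (dualcoord A z i))%:C.
Proof.
have -> : M.+1%:R ^+ d * \prod_i fejer M (dualcoord A z i) =
    \prod_i \sum_(m < M.+1) dirichlet m (dualcoord A z i).
  rewrite -[d in _ ^+ d]card_ord -prodr_const -big_split/=; apply: eq_bigr => i _.
  by rewrite /fejer mulrA mulfV ?mul1r.
rewrite bigA_distr_bigA/= rmorph_sum/= mulr_sumr; apply: eq_bigr => m _.
rewrite -sum_box_e2pi !fsbig_finite ?mulr_sumr; try exact: finite_box.
by apply: eq_bigr => k _; rewrite dot_translate e2piD.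
Qed.

Let b : R := `|\det B|^-1.

Definition fejer_mean (g : R -> R) x M : R :=
  b * \int[mu]_(z in Omega) (g (2 * pi * dot x z) * \prod_i fejer M (dualcoord A z i)).

(** The last hypothesis on g is the real part of [cesaro_kernel] for the cosine and
    its imaginary part for the sine. *)
Lemma cesaro_integral (g : R -> R) M x : (forall t, `|g t| <= 1) ->
  measurable_fun setT (g : measurableTypeR R -> R) ->
  (forall z, \sum_(m : {ffun 'I_d -> 'I_M.+1}) \sum_(k \in box m)
      g (2 * pi * dot (x + A *m intV R k) z) =
    g (2 * pi * dot x z) * (M.+1%:R ^+ d * \prod_i fejer M (dualcoord A z i))) ->
  \sum_(m : {ffun 'I_d -> 'I_M.+1}) \sum_(k \in box m)
    \int[mu]_(z in Omega) g (2 * pi * dot (x + A *m intV R k) z) =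
  M.+1%:R ^+ d *
    \int[mu]_(z in Omega) (g (2 * pi * dot x z) * \prod_i fejer M (dualcoord A z i)).
Proof.
move=> g1 mg gE.
have mgd y : measurable_fun setT (fun z : lebV R d => g (2 * pi * dot y z)).
  exact: (measurable_fun_lebV (measurableT_comp mg (measurable_dot y))).
have ig y := integrable_bounded (mgd y) (fun z => g1 _).
have fb m := @finite_box d M.+1 m.
have igk m : mu.-integrable Omega (EFin \o (fun z : lebV R d =>
    \sum_(k <- finmap.enum_fset (fset_set (@box d M.+1 m)))
      g (2 * pi * dot (x + A *m intV R k) z))).
  exact: integrable_Rsum.
transitivity (\int[mu]_(z in Omega) \sum_(m : {ffun 'I_d -> 'I_M.+1})
    \sum_(k <- finmap.enum_fset (fset_set (@box d M.+1 m))) g (2 * pi * dot (x + A *m intV R k) z)).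
  rewrite Rintegral_sum//; apply: eq_bigr => m _; rewrite fsbig_finite//=.
  by rewrite Rintegral_sum.
rewrite -RintegralZl//.
  apply: eq_Rintegral => z _; rewrite mulrCA -gE.
  by apply: eq_bigr => m _; rewrite fsbig_finite.
have := integrable_RZl mO (M.+1%:R ^- d)
  (integrable_Rsum mO (index_enum {ffun 'I_d -> 'I_M.+1}) xpredT igk).
congr integrable; apply/funext => z; rewrite /=; congr EFin.
transitivity ((M.+1%:R ^- d) * (\sum_(m : {ffun 'I_d -> 'I_M.+1}) \sum_(k \in box m)
      g (2 * pi * dot (x + A *m intV R k) z))).
  by congr (_ * _); apply: eq_bigr => m _; rewrite fsbig_finite.
by rewrite gE mulrCA mulKf// expf_neq0.
Qed.

Lemma cesaro_mean M x :
  (M.+1 ^ d)%:R^-1 * \sum_(m : {ffun 'I_d -> 'I_M.+1}) \sum_(k \in box m)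
    Psi B Omega (x + A *m intV R k) =
  fejer_mean (@cos R) x M +i* fejer_mean (@sin R) x M.
Proof.
have mc := @measurable_cosR R; have ms := @measurable_sinR R.
have kE z := cesaro_kernel M x z.
have cE z : \sum_(m : {ffun 'I_d -> 'I_M.+1}) \sum_(k \in box m)
    e2pi (dot (x + A *m intV R k) z) =
    (\sum_(m : {ffun 'I_d -> 'I_M.+1}) \sum_(k \in box m)
      cos (2 * pi * dot (x + A *m intV R k) z)) +i*
    (\sum_(m : {ffun 'I_d -> 'I_M.+1}) \sum_(k \in box m)
      sin (2 * pi * dot (x + A *m intV R k) z)).
  rewrite -sum_complex; apply: eq_bigr => m _.
  by rewrite !fsbig_finite ?sum_complex; try exact: finite_box.
have mulC (c p q : R) : c%:C * (p +i* q) = (c * p) +i* (c * q).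
  by apply/eqP; rewrite eq_complex /= !mul0r subr0 addr0 !eqxx.
have PsiE : \sum_(m : {ffun 'I_d -> 'I_M.+1}) \sum_(k \in box m)
    Psi B Omega (x + A *m intV R k) = b%:C * (
    (\sum_(m : {ffun 'I_d -> 'I_M.+1}) \sum_(k \in box m)
      \int[mu]_(z in Omega) cos (2 * pi * dot (x + A *m intV R k) z)) +i*
    (\sum_(m : {ffun 'I_d -> 'I_M.+1}) \sum_(k \in box m)
      \int[mu]_(z in Omega) sin (2 * pi * dot (x + A *m intV R k) z))).
  rewrite -sum_complex mulr_sumr; apply: eq_bigr => m _.
  rewrite !fsbig_finite; try exact: finite_box.
  by rewrite -sum_complex mulr_sumr.
have Ec := cesaro_integral (@cos_max R) mc (M := M) (x := x).
have Es := cesaro_integral (@sin_max R) ms (M := M) (x := x).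
rewrite PsiE Ec ?Es.
- have -> : (M.+1 ^ d)%:R = (M.+1%:R ^+ d)%:C :> R[i].
    by rewrite rmorphXn/= rmorph_nat natrX.
  rewrite -fmorphV/= (mulC b) (mulC _ (b * _)) /fejer_mean; congr (_ +i* _).
  + by rewrite mulrCA mulKf// expf_neq0.
  + by rewrite mulrCA mulKf// expf_neq0.
- by move=> z; have := kE z; rewrite cE => -[_ ->]; rewrite mulr0 add0r.
- by move=> z; have := kE z; rewrite cE => -[-> _]; rewrite mulr0 subr0.
Qed.

Lemma phi_dot x (k : 'cV[int]_d) : phi A k x = e2pi (dot x (node A k)).
Proof.
rewrite /phi /dot /node; congr e2pi.
transitivity (((intV R k)^T *m invmx A *m x)^T 0 0); first by rewrite [RHS]mxE.
by rewrite !trmx_mul trmxK trmx_inv mulmxA.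
Qed.

Lemma cvg_cesaro_mean x :
  lattice_sum (fun j => Psi B Omega (x + A *m intV R j)) (fundamental A N Omega x).
Proof.
rewrite /lattice_sum; under eq_fun do rewrite cesaro_mean.
have detNE : (`|\det N|%N)%:R = `|\det B| * `|\det A| :> R.
  by rewrite natr_absz intr_norm -det_map_mx NE det_mulmx det_tr normrM.
have cu g : continuous g -> continuous (fun z => g (2 * pi * dot x z) : R).
  move=> cg z; apply: (@continuous_comp _ _ _ (fun z => 2 * pi * dot x z) g); last exact: cg.
  apply: (@continuous_comp _ _ _ (dot x) ( *%R (2 * pi))); first exact: continuous_dot.
  exact: mulrl_continuous.
have mc := @measurable_cosR R; have ms := @measurable_sinR R.
have lim g : measurable_fun setT (g : measurableTypeR R -> R) -> continuous g ->
    (forall t, `|g t| <= 1) -> fejer_mean g x @ \oo -->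
    b * (`|\det A|^-1 * \sum_(k \in Lambda A Omega) g (2 * pi * dot x (node A k))).
  move=> mg cg g1; apply: cvgMr.
  pose u z := g (2 * pi * dot x z).
  have mu' : measurable_fun setT (u : lebV R d -> R).
    exact: (measurable_fun_lebV (measurableT_comp mg (measurable_dot x))).
  exact: (@cvg_fejer_mean R d A uA Omega r mO Or bO u mu' (fun z => g1 _) (cu g cg)).
suff -> : fundamental A N Omega x =
    (b * (`|\det A|^-1 * \sum_(k \in Lambda A Omega) cos (2 * pi * dot x (node A k)))) +i*
    (b * (`|\det A|^-1 * \sum_(k \in Lambda A Omega) sin (2 * pi * dot x (node A k)))).
  apply: cvg_complex; apply: lim => //.
  - exact: continuous_cos.
  - exact: cos_max.
  - exact: continuous_sin.
  - exact: sin_max.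
have finL : finite_set (Lambda A Omega).
  apply: (sub_finite_set (B := range (@shiftV d r))); last exact: finite_image.
  move=> k kL; have [|s <-] := @shiftV_surj d r k; last by exists s.
  by move=> i; exact: Lambda_bound kL.
rewrite /fundamental -(rmorph_nat (@real_complex R)) detNE !fsbig_finite//=.
rewrite -fmorphV/= invfM.
under eq_bigr do rewrite phi_dot.
rewrite sum_complex; apply/eqP; rewrite eq_complex /= !mul0r subr0 addr0 -!mulrA.
by rewrite !eqxx.
Qed.

End cesaro.

(** * Trigonometric interpolation on lattice tiles *)

Theorem theorem2p6 (R : realType) (d : nat) (hd : (0 < d)%N)
  (A B : 'M[R]_d) (N : 'M[int]_d) (OmegaA OmegaB : set 'cV[R]_d)
  (hA : A \in unitmx) (hB : B \in unitmx)
  (hN : map_mx intr N = B^T *m A)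
  (bndA : bounded_set OmegaA) (bndB : bounded_set OmegaB)
  (measA : measurable (OmegaA : set (lebV R d)))
  (measB : measurable (OmegaB : set (lebV R d)))
  (intA : OmegaA^° 0) (intB : OmegaB^° 0)
  (tilA : tiles OmegaA A) (tilB : tiles OmegaB B) :
  [/\ forall f : 'cV[R]_d -> R[i]^o, {within OmegaA, continuous f} ->
        [/\ phi_span A (Lambda A OmegaB) (interpolant A B N OmegaA OmegaB f),
            (forall j, Lambda B OmegaA j ->
               interpolant A B N OmegaA OmegaB f (node B j) = f (node B j))
          & (forall g, phi_span A (Lambda A OmegaB) g ->
               (forall j, Lambda B OmegaA j -> g (node B j) = f (node B j)) ->
               g = interpolant A B N OmegaA OmegaB f)],
      (Lambda B OmegaA #= `I_(`|\det N|%N))%card,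
      (Lambda A OmegaB #= `I_(`|\det N|%N))%card
    & (forall k, ~ boundary OmegaB (node A k)) ->
        forall x, lattice_sum (fun j => Psi B OmegaB (x + A *m intV R j))
                              (fundamental A N OmegaB x)].
Proof.
have detN : \det N != 0.
  by rewrite -(@intr_eq0 R) -det_map_mx hN -unitfE -unitmxE unitmx_mul unitmx_tr hB.
have NTE : map_mx intr N^T = A^T *m B by rewrite -map_trmx hN trmx_mul trmxK.
have [r Or] := bounded_dualcoord A bndB.
split.
- move=> f _; split.
  + exact: phi_span_interpolant.
  + by move=> j; exact: interpolant_node.
  + by move=> g; exact: interpolant_unique.
- exact: (card_residues detN (tiles_residues hB hN tilA)).
- rewrite -det_tr; apply: card_residues; first by rewrite det_tr.
  exact: (tiles_residues hA NTE tilB).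
- by move=> bO x; exact: (cvg_cesaro_mean hA hN measB Or bO).
Qed.
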